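(* Let $\epsilon>0$ and let $(\rho,\mathbf m,E,\mathbf B)$ be a smooth solution on $D=\mathbb R^d\times[0,+\infty)$, with $\nabla\cdot\mathbf B=0$ and with positive initial density $\rho(\cdot,0)>0$, of the regularized MHD system $$\begin{aligned} &\partial_t\rho+\nabla\cdot\mathbf m=\epsilon\Delta\rho,\\ &\partial_t\mathbf m+\nabla\cdot(\mathbf m\otimes\mathbf u+p\,\mathbb I)-\nabla\cdot\boldsymbol\beta=\epsilon\Delta\mathbf m,\\ &\partial_tE+\nabla\cdot(\mathbf u(E+p))-\nabla\cdot(\mathbf u\cdot\boldsymbol\beta)=\epsilon\Delta E,\\ &\partial_t\mathbf B+\nabla\cdot(\mathbf u\otimes\mathbf B-\mathbf B\otimes\mathbf u)=\epsilon\Delta\mathbf B . \end{aligned}$$ Assume that: (i) $\mathbf u\in L^1(D)$ and $\nabla\cdot\mathbf u\in L^1(D)$; (ii) $\int_0^{+\infty}(\partial_t\rho+\nabla\cdot\mathbf m)\,dt\in L^1(\mathbb R^d)$ and $\int_0^{+\infty}\epsilon\nabla\rho\,dt\in L^1(\mathbb R^d)$; (iii) there exists $\rho_{\min}>0$ such that for every $\widehat t>0$ there is a radius $R_{\widehat t}<\infty$ such that, outside of the closed ball of $\mathbb R^d$ centered at the origin with radius $R_{\widehat t}$, $\rho(\mathbf x,t)\ge\rho_{\min}$ for all $t\in(0,\widehat t\,)$; and $\int_0^{\widehat t}(\nabla\cdot\mathbf u(\mathbf x,t))^+\,dt\in L^\infty(\mathbb R^d)$ for every $\widehat t>0$; (iv)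 $\mathbf B\in L^1(D)$; (v) the density $\rho$ and the specific internal energy $e$ converge uniformly to constant states $\rho^*$, $e^*$ as $|\mathbf x|\to\infty$ and remain constant outside of a compact set of $\mathbb R^d$. Then the minimum entropy principle holds: for all $t>0$, $$\inf_{\mathbf x\in\mathbb R^d}s(\mathbf x,t)\ \ge\ \inf_{\mathbf x\in\mathbb R^d}s_0(\mathbf x),$$ where $s(\mathbf x,t):=s(\rho(\mathbf x,t),e(\mathbf x,t))$ and $s_0(\mathbf x):=s(\mathbf x,0)$.
   Context: Here $d\ge1$ is the space dimension, $\rho,E:D\to\mathbb R$ are density and total energy, and $\mathbf m,\mathbf B:D\to\mathbb R^d$ are momentum and magnetic field. The velocity is $\mathbf u:=\mathbf m/\rho$; $\mathbb I$ is the $d\times d$ identity; the Maxwell stress tensor is $\boldsymbol\beta:=-\tfrac12(\mathbf B\cdot\mathbf B)\mathbb I+\mathbf B\otimes\mathbf B$. Convention: for a matrix field $A$, $(\nabla\cdot A)_j=\sum_i\partial_iA_{ij}$, $(\mathbf a\otimes\mathbf b)_{ij}=a_ib_j$, $(\mathbf u\cdot\boldsymbol\beta)_j=\sum_iu_i\beta_{ij}$; the Laplacian acts componentwise; $(\cdot)^+$ is the positive part. The specific internal energy $e$ is defined by $\rho e:=E-\tfrac12\rho|\mathbf u|^2-\tfrac12|\mathbf B|^2$. Thermodynamics: the specific entropy $s=s(\rho,e)$ is a smooth function of $\rho>0$ and $e$; subscripts denote partial derivatives with respect to $\rho$ and $e$. It satisfies $de=T\,ds+\frac{p}{\rho^2}d\rho$,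 i.e. the temperature is $T=1/s_e$ and the pressure $p$ is given by the equation of state $p\,s_e+\rho^2s_\rho=0$. Standing assumptions: $s_e>0$ (positive temperature), and $-s$ is strictly convex as a function of $(\rho^{-1},e)$, in the sense that its Hessian is positive definite; equivalently $\partial_\rho(\rho^2s_\rho)<0$, $s_{ee}<0$ and $\partial_\rho(\rho^2s_\rho)s_{ee}-\rho^2s_{\rho e}^2>0$. No assumption is made on the sign of $p$. *)

(* Defs.v *)
From HB Require Import structures.
From mathcomp Require Import all_boot all_order all_algebra.
From mathcomp Require Import all_classical all_reals all_analysis.
From mathcomp Require Import measurable_realfun.

Set Implicit Arguments.
Unset Strict Implicit.
Unset Printing Implicit Defensive.
Import Order.TTheory GRing.Theory Num.Theory.
Import numFieldNormedType.Exports.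

Local Open Scope classical_set_scope.
Local Open Scope ring_scope.

Section smoothness.
Context {R : realType} {V W : normedModType R}.

(* On an open set U of a finite-dimensional space this is the usual class C^k:
   each step asks for Frechet differentiability on U and for all directional
   derivatives to be of class C^(k-1). *)
Fixpoint class_C (k : nat) (U : set V) (f : V -> W) : Prop :=
  match k with
  | 0 => forall x, U x -> {for x, continuous f}
  | k'.+1 => (forall x, U x -> differentiable f x) /\
             (forall v : V, class_C k' U ('D_v f))
  end.

Definition class_Cinfty (U : set V) (f : V -> W) : Prop :=
  forall k, class_C k U f.

(* Smoothness on an arbitrary set, e.g. up to the boundary of a closed
   half-space: f has a smooth extension to an open neighbourhood. *)
Definition smooth_on (A : set V) (f : V -> W) : Prop :=
  exists (U : set V) (F : V -> W),
    [/\ open U, A `<=` U, class_Cinfty U F & forall x, A x -> F x = f x].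

End smoothness.

Section lebesgue_cons.
Local Open Scope ereal_scope.
Context {R : realType} (n : nat).
Variable mu : {sigma_finite_measure set (n.-tuple R) -> \bar R}.

Definition cons_pair (y : R * n.-tuple R) : n.+1.-tuple R :=
  [tuple of y.1 :: y.2].

Lemma measurable_cons_pair : measurable_fun setT cons_pair.
Proof. exact: measurable_cons measurable_fst measurable_snd. Qed.

Definition lebesgue_cons : set (n.+1.-tuple R) -> \bar R :=
  pushforward (@lebesgue_measure R \x mu) cons_pair.

Let lebesgue_cons0 : lebesgue_cons set0 = 0.
Proof. by rewrite /lebesgue_cons /pushforward preimage_set0 measure0. Qed.

Let lebesgue_cons_ge0 A : 0 <= lebesgue_cons A.
Proof. by rewrite /lebesgue_cons /pushforward. Qed.

Let lebesgue_cons_sigma_additive : semi_sigma_additive lebesgue_cons.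
Proof.
move=> F mF tF mUF; rewrite /lebesgue_cons /pushforward preimage_bigcup.
apply: measure_semi_sigma_additive.
- by move=> i; rewrite -[X in measurable X]setTI; exact: measurable_cons_pair.
- apply/trivIsetP => /= i j _ _ ij; rewrite -preimage_setI.
  by move/trivIsetP : tF => /(_ _ _ _ _ ij) ->//; rewrite preimage_set0.
- by rewrite -preimage_bigcup -[X in measurable X]setTI;
     exact: measurable_cons_pair.
Qed.

HB.instance Definition _ := isMeasure.Build _ _ _ lebesgue_cons
  lebesgue_cons0 lebesgue_cons_ge0 lebesgue_cons_sigma_additive.

Let lebesgue_cons_sigma_finite : sigma_finite setT lebesgue_cons.
Proof.
have [F TF Foo] := sigma_finiteT (@lebesgue_measure R).
have [G TG Goo] := sigma_finiteT mu.
pose H (k : nat * nat) := F k.1 `*` G k.2.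
have [f sf] : exists f : nat -> nat * nat, forall k, exists i, f i = k.
  exists (fun i => odflt (0%N, 0%N) (unpickle i)) => k.
  by exists (pickle k); rewrite pickleK.
pose g (x : n.+1.-tuple R) := (thead x, [tuple of behead x]).
have gc y : g (cons_pair y) = y.
  by case: y => a t; rewrite /g /cons_pair/= theadE; congr pair; exact: val_inj.
have mg : measurable_fun setT g.
  apply: measurable_fun_pair; last exact: measurable_behead.
  exact: measurable_tnth.
exists (fun i => g @^-1` H (f i)).
  apply/esym/seteqP; split => // x _.
  have [i _ Fi] : (\bigcup_i F i) (g x).1 by rewrite -TF.
  have [j _ Gj] : (\bigcup_i G i) (g x).2 by rewrite -TG.
  by have [k fk] := sf (i, j); exists k => //; rewrite /preimage/= fk.
move=> i; have [mF Ffin] := Foo (f i).1; have [mG Gfin] := Goo (f i).2.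
split.
  rewrite -[X in measurable X]setTI; apply: mg => //; exact: measurableX.
rewrite /lebesgue_cons /pushforward -comp_preimage.
rewrite (_ : g \o cons_pair = id) ?preimage_id; last by apply/funext => y /=.
by rewrite product_measure1E// lte_mul_pinfty// ge0_fin_numE.
Qed.

HB.instance Definition _ := Measure_isSigmaFinite.Build _ _ _ lebesgue_cons
  lebesgue_cons_sigma_finite.

End lebesgue_cons.

(* The Lebesgue measure of R^n, on the product sigma-algebra of n.-tuple R. *)
Fixpoint lebesgue_tuple (R : realType) (n : nat) :
    {sigma_finite_measure set (n.-tuple R) -> \bar R} :=
  match n with
  | 0 => @dirac _ (0.-tuple R) [tuple] R
  | n'.+1 => lebesgue_cons (lebesgue_tuple R n')
  end.

Lemma lebesgue_tuple_box (R : realType) (n : nat) (A : 'I_n -> set R) :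
  (forall i, measurable (A i)) ->
  lebesgue_tuple R n [set x | forall i, A i (tnth x i)] =
  (\prod_(i < n) @lebesgue_measure R (A i))%E.
Proof.
elim: n A => [|n IH] A mA.
  rewrite big_ord0 /= diracE mem_set//= => -[]//.
rewrite big_ord_recl -IH//= /lebesgue_cons /pushforward.
rewrite -product_measure1E//.
  congr (_ _); apply/seteqP; split => [[a t] /= h|[a t] /= [h0 h] i].
    by split=> [|i]; [have := h ord0|have := h (lift ord0 i); rewrite tnthS].
  by case: (unliftP ord0 i) => [j|] ->; rewrite ?tnthS//; exact: h.
  exact: mA.
rewrite (_ : [set _ | _] =
    \bigcap_(i in [set: 'I_n]) ((@tnth n R)^~ i @^-1` A (lift ord0 i))).
  apply: fin_bigcap_measurable => // i _.
  by rewrite -[X in measurable X]setTI; exact: measurable_tnth.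
by apply/seteqP; split => x /= h i *; exact: h.
Qed.

(* Points of R^d are row vectors, points of space-time are pairs (x, t).  The
   library norm on row vectors is the sup norm, so the Euclidean one is given
   separately. *)
Section fields.
Context {R : realType} {d : nat}.
Implicit Types (f : 'rV[R]_d * R -> R) (a b : 'rV[R]_d * R -> 'rV[R]_d)
  (A : 'rV[R]_d * R -> 'M[R]_d) (z : 'rV[R]_d * R) (x y : 'rV[R]_d).

Definition dot x y : R := \sum_i x 0 i * y 0 i.

Definition enorm x : R := Num.sqrt (dot x x).

Definition half_spacetime : set ('rV[R]_d * R) := [set z | 0 <= z.2].

Definition vcomp a (j : 'I_d) : 'rV[R]_d * R -> R := fun z => a z 0 j.

Definition dt f : 'rV[R]_d * R -> R := 'D_((0, 1) : 'rV[R]_d * R) f.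

Definition dx (i : 'I_d) f : 'rV[R]_d * R -> R :=
  'D_((delta_mx 0 i, 0) : 'rV[R]_d * R) f.

Definition laplacian f z : R := \sum_i dx i (dx i f) z.

Definition divergence a z : R := \sum_i dx i (vcomp a i) z.

Definition mx_divergence A (j : 'I_d) z : R :=
  \sum_i dx i (fun z' => A z' i j) z.

Definition outer x y : 'M[R]_d := x^T *m y.

Definition smooth_field f : Prop := smooth_on half_spacetime f.

Definition smooth_vfield a : Prop := forall j, smooth_field (vcomp a j).

End fields.

Section integrability.
Local Open Scope ereal_scope.
Context {R : realType} {d : nat}.

Definition row_of_tuple (x : d.-tuple R) : 'rV[R]_d := (\row_i tnth x i)%R.

Definition L1_space (F : 'rV[R]_d -> \bar R) : Prop :=
  (lebesgue_tuple R d).-integrable setT (F \o row_of_tuple).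

Definition Linfty_space (F : 'rV[R]_d -> \bar R) : Prop :=
  measurable_fun setT (F \o row_of_tuple) /\
  Lnorm (lebesgue_tuple R d) +oo (F \o row_of_tuple) < +oo.

Definition L1_spacetime (f : 'rV[R]_d * R -> R) : Prop :=
  (lebesgue_tuple R d \x @lebesgue_measure R).-integrable
    (setT `*` `[0%R, +oo[) (fun y => (f (row_of_tuple y.1, y.2))%:E).

(* Lebesgue integral in time; when both the positive and the negative part have
   infinite integral its value is -oo, so that L1_space (time_integral I f)
   includes the existence of the time integral at almost every x. *)
Definition time_integral (I : set R) (f : 'rV[R]_d * R -> R)
    (x : 'rV[R]_d) : \bar R :=
  \int[@lebesgue_measure R]_(t in I) (f (x, t))%:E.

End integrability.

Section thermodynamics.
Context {R : realType}.
Implicit Types (f : R * R -> R) (q : R * R).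

Definition partial1 f : R * R -> R := 'D_((1, 0) : R * R) f.
Definition partial2 f : R * R -> R := 'D_((0, 1) : R * R) f.

Definition hessian f q : 'M[R]_2 :=
  \matrix_(i < 2, j < 2)
    let D (k : 'I_2) := if k == 0 then partial1 else partial2 in D i (D j f) q.

Definition pos_def (A : 'M[R]_2) : Prop :=
  forall w : 'rV[R]_2, w != 0 -> 0 < (w *m A *m w^T) 0 0.

(* States are pairs (rho, e).  Ie is the open set of admissible specific
   internal energies, e.g. setT, or the positive reals for an ideal gas. *)
Definition states (Ie : set R) : set (R * R) := [set q | 0 < q.1 /\ Ie q.2].

(* Convexity of -s is expressed in the variables (1/rho, e). *)
Record entropy_pressure (Ie : set R) (s p : R * R -> R) : Prop := {
  admissible_open : open Ie;
  entropy_smooth : class_Cinfty (states Ie) s;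
  temperature_gt0 : forall q, states Ie q -> 0 < partial2 s q;
  entropy_convex : forall q, states Ie q ->
    pos_def (hessian (fun q' => - s (q'.1^-1, q'.2)) (q.1^-1, q.2));
  equation_of_state : forall q, states Ie q ->
    p q * partial2 s q + q.1 ^+ 2 * partial1 s q = 0
}.

End thermodynamics.

Section mhd.
Context {R : realType} {d : nat}.
Implicit Types (rho E : 'rV[R]_d * R -> R) (m B : 'rV[R]_d * R -> 'rV[R]_d).

Definition velocity rho m : 'rV[R]_d * R -> 'rV[R]_d :=
  fun z => (rho z)^-1 *: m z.

Definition internal_energy rho m E B : 'rV[R]_d * R -> R := fun z =>
  (E z - 2^-1 * rho z * dot (velocity rho m z) (velocity rho m z)
       - 2^-1 * dot (B z) (B z)) / rho z.

Definition maxwell_stress B : 'rV[R]_d * R -> 'M[R]_d := fun z =>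
  - (2^-1 * dot (B z) (B z))%:M + outer (B z) (B z).

(* Positivity of rho is not assumed for t > 0.  Regularity of the velocity,
   which is differentiated in the system, is part of being a smooth solution.
   The equations are imposed for t > 0, where the two-sided time derivative
   only sees values on the half-space-time; they extend to t = 0 by
   continuity. *)
Record smooth_mhd_solution (Ie : set R) (p : R * R -> R) (eps : R)
    rho m E B : Prop := {
  density_smooth : smooth_field rho;
  momentum_smooth : smooth_vfield m;
  energy_smooth : smooth_field E;
  magnetic_smooth : smooth_vfield B;
  velocity_smooth : smooth_vfield (velocity rho m);
  energy_admissible : forall z, half_spacetime z -> 0 < rho z ->
    Ie (internal_energy rho m E B z);
  magnetic_div0 : forall z, half_spacetime z -> divergence B z = 0;
  mass_equation : forall z, 0 < z.2 ->
    dt rho z + divergence m z = eps * laplacian rho z;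
  momentum_equation :
    let u := velocity rho m in
    let P z := p (rho z, internal_energy rho m E B z) in
    forall (j : 'I_d) z, 0 < z.2 ->
    dt (vcomp m j) z
      + mx_divergence (fun z' => outer (m z') (u z') + (P z')%:M) j z
      - mx_divergence (maxwell_stress B) j z
    = eps * laplacian (vcomp m j) z;
  energy_equation :
    let u := velocity rho m in
    let P z := p (rho z, internal_energy rho m E B z) in
    forall z, 0 < z.2 ->
    dt E z + divergence (fun z' => (E z' + P z') *: u z') z
      - divergence (fun z' => u z' *m maxwell_stress B z') z
    = eps * laplacian E z;
  induction_equation :
    let u := velocity rho m in
    forall (j : 'I_d) z, 0 < z.2 ->
    dt (vcomp B j) z
      + mx_divergence (fun z' => outer (u z') (B z') - outer (B z') (u z')) j z
    = eps * laplacian (vcomp B j) z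
}.

End mhd.

(* Main.v *)
Require Import Defs.
From HB Require Import structures.
From mathcomp Require Import all_boot all_order all_algebra.
From mathcomp Require Import all_classical all_reals all_analysis.
From mathcomp Require Import measurable_realfun.
From mathcomp Require Import ring lra.
Import Order.TTheory GRing.Theory Num.Theory.
Import numFieldNormedType.Exports.

Local Open Scope classical_set_scope.
Local Open Scope ring_scope.

(** The specific entropy of a solution satisfies, for positive times,
      [dt s + u . grad s >= eps (lap s + (2 / rho) grad rho . grad s)]
    ([entropy_transport_ge0]), and outside a compact set it does not change in
    time.  Such a function cannot fall below its initial infimum [c]: compare it
    with [c - delta (1 + t)].  At a first point of contact from above the spatial
    gradient vanishes, the Laplacian is nonnegative and the time derivative is at
    most [- delta], which contradicts the inequality ([first_contact],
    [barrier_principle], [entropy_minimum_principle]).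

    The inequality rests on two differential operators, the conservative
    [balance] and the convective [transport].  Every conservation law prescribes
    a [balance], and once [rho] satisfies the mass equation,
      [balance (rho f) = rho * transport f]
    ([balanceM]); the term [2 / rho] is what the Laplacian of a product leaves.
    Taking the kinetic and the magnetic energy off the total energy cancels all
    work terms except that of the pressure, and each square contributes the
    square of its gradient ([transport_internal_energy]):
      [rho * transport e = - p div u + eps (rho |grad u|^2 + |grad B|^2)].
    In the same way [rho * transport (1 / rho) = div u] ([transport_volume]).
    Now write [- s] as a convex function of [(1 / rho, e)] and apply the chain
    rule ([transport_comp2]).  The terms with [div u] cancel by the equation of
    state; what is left is [- eps s_e] times the dissipation and [- eps rho] times
    the Hessian of [- s] on the gradients of [1 / rho] and [e], both nonpositive
    ([transport_entropy_ge0]).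

    All this needs [rho > 0].  Where [rho] is positive the mass equation is an
    advection-diffusion equation with the source [- rho div u], and [div u] is
    bounded on compact sets up to time zero, so the barrier [c exp (- M t)] with [M] above
    [div u] keeps [rho] positive ([density_gt0]). *)

(** * Functions of class C^k *)

Section calculus.
Context {R : realType} {V : normedModType R}.
Implicit Types (A : set V) (f g : V -> R) (v z : V).

Lemma derive_eq_on {A : set V} {f g : V -> R} {v z : V} :
  open A -> (forall y, A y -> f y = g y) -> A z -> 'D_v f z = 'D_v g z.
Proof.
move=> oA fg Az; apply: near_eq_derive.
by near=> y; apply: fg; near: y; exact: open_nbhs_nbhs.
Unshelve. all: by end_near. Qed.

(** The difference [g - f] vanishes near [z], hence is [o(h)] there with zero
    differential. *)
Lemma differentiable_eq_on {A : set V} {f g : V -> R} {z : V} :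
  open A -> (forall y, A y -> f y = g y) -> A z ->
  differentiable f z -> differentiable g z.
Proof.
move=> oA fg Az df; rewrite (_ : g = f + (g - f)); last first.
  by apply/funext => y; rewrite !fctE addrC subrK.
apply: differentiableD => //; set h := g - f.
have h0 y : A y -> h y = 0 by move=> Ay; rewrite /h !fctE fg// subrr.
have nA : \forall y \near (0 : V), A (y + z).
  have : nbhs z A by exact: open_nbhs_nbhs.
  by rewrite -[nbhs z A]/(\near z, A z) (near_shift 0 z) /= subr0.
have hloc : h \o shift z = cst (h z) + (\0 : {linear V -> R}) +o_ 0 id.
  apply/eqaddoP => e e0; near=> y.
  rewrite !fctE /= !h0// ?addr0 ?subrr ?normr0 ?mulr_ge0 ?(ltW e0)//.
  by near: y.
apply/diff_locallyP; have hd := diff_unique _ hloc.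
rewrite hd; last exact: cst_continuous.
by split => //; exact: cst_continuous.
Unshelve. all: by end_near. Qed.

Lemma deriveM_fun {f g : V -> R} {v z : V} :
  differentiable f z -> differentiable g z ->
  'D_v (fun y => f y * g y) z = f z * 'D_v g z + g z * 'D_v f z.
Proof. by move=> df dg; rewrite [LHS](@deriveM _ _ f g)//; exact: diff_derivable. Qed.

Lemma deriveD_fun {f g : V -> R} {v z : V} :
  differentiable f z -> differentiable g z ->
  'D_v (fun y => f y + g y) z = 'D_v f z + 'D_v g z.
Proof. by move=> df dg; rewrite [LHS](@deriveD _ _ _ f g)//; exact: diff_derivable. Qed.

Lemma derive_sum_fun {n} {f : 'I_n -> V -> R} {v z : V} :
  (forall i, differentiable (f i) z) ->
  'D_v (fun y => \sum_i f i y) z = \sum_i 'D_v (f i) z.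
Proof.
move=> df; rewrite -derive_sum; last by move=> i; exact: diff_derivable.
by congr ('D_v _ z); apply/funext => y; rewrite fct_sumE.
Qed.

Lemma derive_comp2 {F : R * R -> R} {f g : V -> R} {v z : V} :
  differentiable f z -> differentiable g z -> differentiable F (f z, g z) ->
  'D_v (fun y => F (f y, g y)) z =
  partial1 F (f z, g z) * 'D_v f z + partial2 F (f z, g z) * 'D_v g z.
Proof.
move=> df dg dF.
have dfg : differentiable (fun y => (f y, g y)) z by exact: differentiable_pair.
have dFfg : differentiable (fun y => F (f y, g y)) z.
  exact: (@differentiable_comp _ _ _ _ (fun y => (f y, g y)) F).
rewrite /partial1 /partial2 !deriveE//.
rewrite (@diff_comp _ _ _ _ (fun y => (f y, g y)) F)//= diff_pair//=.
(* split the increment along the two coordinate directions *)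
rewrite -[X in 'd F _ X](_ : 'd f z v *: (1, 0) + 'd g z v *: (0, 1) = _).
  by rewrite linearD !linearZ/= mulrC [X in _ + X]mulrC.
by congr pair; rewrite /= ?scaler0 ?addr0 ?add0r//; exact: mulr1.
Qed.

Lemma class_C_subset {k} {A B : set V} {f : V -> R} :
  A `<=` B -> class_C k B f -> class_C k A f.
Proof.
move=> AB; elim: k f => [|k IH] f /=; first by move=> cf x /AB; exact: cf.
by move=> [df cf]; split=> [x /AB|v]; [exact: df|exact: IH].
Qed.

(** The differentiation rules give formulas for ['D_v] that hold on [A] only;
    this lemma lets the inductions below pass through them. *)
Lemma class_C_eq {k} {A : set V} {f g : V -> R} :
  open A -> (forall y, A y -> f y = g y) -> class_C k A f -> class_C k A g.
Proof.
move=> oA; elim: k f g => [|k IH] f g fg /=.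
  move=> cf x Ax; rewrite /prop_for /continuous_at -fg//.
  apply: cvg_trans (cf x Ax); apply: near_eq_cvg.
  by near=> y; apply: fg; near: y; exact: open_nbhs_nbhs.
move=> [df cf]; split=> [x Ax|v].
  by apply: (differentiable_eq_on oA fg Ax); exact: df.
by apply: IH (cf v) => y Ay; exact: derive_eq_on oA fg Ay.
Unshelve. all: by end_near. Qed.

Lemma class_CW {k} {A : set V} {f : V -> R} : class_C k.+1 A f -> class_C k A f.
Proof.
elim: k f => [|k IH] f /= [df cf]; last by split=> // v; exact: IH.
by move=> x Ax; apply: differentiable_continuous; exact: df.
Qed.

Lemma class_C1_diff {k} {A : set V} {f : V -> R} {z} :
  class_C k.+1 A f -> A z -> differentiable f z.
Proof. by case=> df _; exact: df. Qed.

Lemma class_C_derive {k} {A : set V} {f : V -> R} (v : V) :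
  class_C k.+1 A f -> class_C k A ('D_v f).
Proof. by case=> _; exact. Qed.

Lemma class_C_cst {k} {A : set V} (c : R) : class_C k A (fun=> c).
Proof.
elim: k c => [|k IH] c /=; first by move=> x _; exact: cst_continuous.
split=> [x _|v]; first exact: differentiable_cst.
by rewrite (_ : 'D_v _ = fun=> 0)//; apply/funext => x; exact: derive_cst.
Qed.

Lemma class_CD {k} {A : set V} {f g : V -> R} : open A ->
  class_C k A f -> class_C k A g -> class_C k A (fun y => f y + g y).
Proof.
move=> oA; elim: k f g => [|k IH] f g /=.
  by move=> cf cg x Ax; apply: cvgD; [exact: cf|exact: cg].
move=> [df cf] [dg cg]; split=> [x Ax|v].
  by apply: differentiableD; [exact: df|exact: dg].
apply: (class_C_eq oA _ (IH _ _ (cf v) (cg v))) => y Ay.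
by rewrite deriveD_fun//; [exact: df|exact: dg].
Qed.

Lemma class_CM {k} {A : set V} {f g : V -> R} : open A ->
  class_C k A f -> class_C k A g -> class_C k A (fun y => f y * g y).
Proof.
move=> oA; elim: k f g => [|k IH] f g.
  by move=> cf cg x Ax; apply: cvgM; [exact: cf|exact: cg].
move=> Cf Cg; have [df cf] := Cf; have [dg cg] := Cg; split=> [x Ax|v].
  by apply: differentiableM; [exact: df|exact: dg].
have := class_CD oA (IH _ _ (class_CW Cf) (cg v)) (IH _ _ (class_CW Cg) (cf v)).
apply: class_C_eq => // y Ay.
by rewrite deriveM_fun//; [exact: df|exact: dg].
Qed.

Lemma class_CN {k} {A : set V} {f : V -> R} : open A ->
  class_C k A f -> class_C k A (fun y => - f y).
Proof.
move=> oA cf; have := class_CM oA (class_C_cst (-1)) cf.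
by apply: class_C_eq => // y _; rewrite mulN1r.
Qed.

Lemma class_C_sum {k n} {A : set V} {f : 'I_n -> V -> R} : open A ->
  (forall i, class_C k A (f i)) -> class_C k A (fun y => \sum_i f i y).
Proof.
move=> oA cf; rewrite (_ : (fun y => _) = \sum_i f i); last first.
  by apply/funext => y; rewrite fct_sumE.
elim/big_rec: _ => [|i h _ ch]; first exact: class_C_cst.
exact: class_CD.
Qed.

Lemma class_C_inv {k} {A : set V} {f : V -> R} : open A ->
  (forall y, A y -> f y != 0) -> class_C k A f -> class_C k A (fun y => (f y)^-1).
Proof.
move=> oA f0; elim: k => [|k IH] cf.
  by move=> x Ax; apply: cvgV; [exact: f0|exact: cf].
have [df dcf] := cf; split=> [x Ax|v].
  by apply: differentiableV; [exact: df|exact: f0].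
have Vk := IH (class_CW cf).
have := class_CN oA (class_CM oA (class_CM oA Vk Vk) (dcf v)).
apply: class_C_eq => // y Ay; rewrite deriveV//; last 2 first.
- exact: f0.
- by apply: diff_derivable; exact: df.
by rewrite -mulNr -invfM.
Qed.

End calculus.

Lemma class_C_comp2 {R : realType} {V : normedModType R} {k} {A : set V}
    {O : set (R * R)} {F : R * R -> R} {f g : V -> R} :
  open A -> (forall y, A y -> O (f y, g y)) -> class_C k O F ->
  class_C k A f -> class_C k A g -> class_C k A (fun y => F (f y, g y)).
Proof.
move=> oA AO; elim: k F => [|k IH] F CF Cf Cg.
  move=> x Ax; apply: (@continuous_comp _ _ _ (fun y => (f y, g y)) F x).
    exact: (cvg_pair (Cf x Ax) (Cg x Ax)).
  exact: CF (AO _ Ax).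
have [dF cF] := CF; have [df cf] := Cf; have [dg cg] := Cg.
split=> [x Ax|v].
  apply: (@differentiable_comp _ _ _ _ (fun y => (f y, g y)) F).
    by apply: differentiable_pair; [exact: df|exact: dg].
  exact: dF (AO _ Ax).
have IHv w := IH _ (cF w) (class_CW Cf) (class_CW Cg).
have := class_CD oA (class_CM oA (IHv (1, 0)) (cf v))
  (class_CM oA (IHv (0, 1)) (cg v)).
apply: class_C_eq => // y Ay.
by rewrite derive_comp2//; [exact: df|exact: dg|exact: dF (AO _ Ay)].
Qed.

(** * First contact and the barrier principle *)

Section first_contact.
Context {R : realType} {X : topologicalType}.
Implicit Types (f : X * R -> R) (b : R -> R) (K : set X).

(** Continuity up to time zero of a function given on the half-space-time is
    stated as continuity of its composite with [clamp_time], on the whole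
    space-time: compositions then involve no relative topology. *)
Definition clamp_time (z : X * R) : X * R := (z.1, Num.max z.2 0).

Lemma clamp_time_id (z : X * R) : 0 <= z.2 -> clamp_time z = z.
Proof. by case: z => x t /= t0; rewrite /clamp_time /= max_l. Qed.

Lemma clamp_time_ge0 (z : X * R) : 0 <= (clamp_time z).2.
Proof. by rewrite /clamp_time /= le_max lexx orbT. Qed.

Lemma continuous_clamp_time : continuous clamp_time.
Proof.
move=> z.
have cfst : {for z, continuous (@fst X R)} by exact: cvg_fst.
have csnd : {for z, continuous (@snd X R)} by exact: cvg_snd.
exact: (cvg_pair cfst (continuous_max csnd (@cst_continuous _ _ (0 : R) z))).
Qed.

(** The points of [K x [0, T]] where [f <= b] form a compact set; take one with
    the least time [t].  At all earlier times [f > b] everywhere, and [f >= b] at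
    time [t] follows by letting the time increase to [t]. *)
Lemma first_contact {f b K} {T : R} : compact K ->
  continuous (f \o clamp_time) -> continuous b ->
  (forall x, b 0 < f (x, 0)) ->
  (forall x t, ~ K x -> 0 <= t -> t <= T -> b t < f (x, t)) ->
  (exists x t, [/\ 0 <= t, t <= T & f (x, t) <= b t]) ->
  exists x t, [/\ 0 < t, t <= T, K x, f (x, t) = b t &
    forall y s, 0 <= s -> s <= t -> b s <= f (y, s)].
Proof.
move=> cK cf cb b0 bK [x1 [t1 [t10 t1T fb1]]].
pose W z := f (clamp_time z) - b z.2.
have cW : continuous W.
  move=> z; apply: cvgB; first exact: cf.
  exact: (@continuous_comp _ _ _ snd b z cvg_snd (cb _)).
have WE y s : 0 <= s -> W (y, s) = f (y, s) - b s.
  by move=> s0; rewrite /W clamp_time_id.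
pose A := (K `*` `[0, T]) `&` [set z | W z <= 0].
have cA : compact A.
  apply: compact_closedI; first by apply: compact_setX => //; exact: segment_compact.
  by apply: (preimage_closed _ (@closed_le _ 0)) => z _; exact: cW.
have inA y s : 0 <= s -> s <= T -> f (y, s) <= b s -> A (y, s).
  move=> s0 sT fs; split; last by rewrite /= WE// subr_le0.
  split; last by rewrite /= in_itv/= s0.
  by apply: contrapT => nK; have := bK y s nK s0 sT; rewrite ltNge fs.
have A0 : A !=set0 by exists (x1, t1); exact: inA.
have cs : {within A, continuous snd}.
  by apply: continuous_subspaceT => z; exact: cvg_snd.
have [[x t] + tmin] := compact_EVT_min A0 cA cs.
rewrite inE => -[[/= Kx]]; rewrite in_itv/= => /andP[t0 tT].
rewrite WE// subr_le0 => fb.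
have tpos : 0 < t.
  rewrite lt_neqAle t0 andbT; apply/eqP => t00.
  by move: fb; rewrite -t00 leNgt b0.
have before y s : 0 <= s -> s < t -> b s < f (y, s).
  move=> s0 st; rewrite ltNge; apply/negP => fs.
  have /(_ (y, s)) := tmin; rewrite inE => /(_ (inA y s s0 _ fs)) /=.
  by rewrite (le_trans (ltW st))// leNgt st => /(_ isT).
have at_t y : b t <= f (y, t).
  rewrite leNgt; apply/negP => fy.
  have W0 : W (y, t) < 0 by rewrite WE// subr_lt0.
  have cWy : (fun s : R => W (y, s)) @ t^'- --> W (y, t).
    apply: cvg_at_left_filter.
    apply: (@continuous_comp _ _ _ (fun s : R => (y, s)) W t _ (cW _)).
    have cy : {for t, continuous (fun=> y)} by exact: cst_continuous.
    have ct : {for t, continuous (fun s : R => s)} by exact: cvg_id.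
    exact: (cvg_pair cy ct).
  have : \forall s \near t^'-, False.
    near=> s.
    have s0 : 0 <= s by near: s; exact: nbhs_left_ge.
    have st : s < t by near: s; exact: nbhs_left_lt.
    have : W (y, s) < 0 by near: s; exact: (cvgr_lt (W (y, t))).
    by rewrite WE// subr_lt0 ltNge (ltW (before _ _ s0 st)).
  by move=> /filter_ex[].
exists x, t; split=> //; first by apply/eqP; rewrite eq_le fb at_t.
move=> y s s0; rewrite le_eqVlt => /predU1P[->//|st]; exact/ltW/before.
Unshelve. all: by end_near. Qed.

End first_contact.

Section minimum_tests.
Context {R : realType}.

Lemma derive1_le0_at_left (w : R -> R) (a t : R) : a < t -> derivable w t 1 ->
  (forall s, a <= s -> s <= t -> w t <= w s) -> 'D_1 w t <= 0.
Proof.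
move=> at_ dw wmin; rewrite ['D_1 w t]cvg_at_leftE; last exact: dw.
apply: limr_le.
  rewrite -(cvg_at_leftE (fun h => h^-1 *: ((w \o shift t) _ - w t))) //.
  apply: cvg_trans dw; apply: cvg_app.
  move=> A [e egt0 Ae]; exists e => // x xe xgt0; apply: Ae => //.
  exact/ltr0_neq0.
near=> h; apply: mulr_le0_ge0.
  by rewrite invr_le0; apply: ltW; near: h; exists 1 => /=.
rewrite subr_ge0 [_%:A]mulr1; apply: wmin.
  near: h; exists (t - a); first by rewrite /= subr_gt0.
  move=> h; rewrite /= distrC subr0 => /ltr_normlP[]; lra.
by rewrite /= gerDr ltW//; near: h; exists 1 => /=.
Unshelve. all: by end_near. Qed.

(** If [psi'(0) < 0], then [psi < 0] to the right of [0], and by the mean value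
    theorem [phi] decreases there. *)
Lemma second_derivative_ge0 (phi psi : R -> R) :
  (forall h : R, is_derive h 1 phi (psi h)) -> derivable psi 0 1 ->
  (forall h, phi 0 <= phi h) -> psi 0 = 0 /\ 0 <= 'D_1 psi 0.
Proof.
move=> dphi dpsi pmin.
have psi0 : psi 0 = 0.
  have h0 : is_derive (0 : R) 1 phi 0.
    apply: (@derive1_at_min _ phi (-1) 1 0) => //.
    by rewrite in_itv/= ltrN10 ltr01.
  by have [_ <-] := dphi 0; have [_] := h0.
split=> //; rewrite leNgt; apply/negP => neg.
have : \forall h \near 0^'+, psi h < 0.
  have /cvgr_lt/(_ 0 neg) := cvg_dnbhs_at_right dpsi.
  move=> lt0; near=> h; have h0 : 0 < h by near: h; exact: nbhs_right_gt.
  have : h^-1 *: ((psi \o shift 0) (h *: 1) - psi 0) < 0 by near: h; exact: lt0.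
  rewrite psi0 subr0 /= addr0 [h%:A]mulr1.
  by rewrite pmulr_rlt0// invr_gt0.
move=> [e /= e0 He]; have e2 : 0 < e / 2 by rewrite divr_gt0.
have cphi : {within `[0, e / 2], continuous phi}.
  apply: derivable_within_continuous => x _.
  by have [] := dphi x.
have [c cin] := @MVT _ phi psi 0 (e / 2) e2 (fun x _ => dphi x) cphi.
move: cin; rewrite in_itv/= => /andP[c0 ce] E.
have pc : psi c < 0.
  by apply: He => //; rewrite /= sub0r normrN gtr0_norm//; lra.
have := pmin (e / 2); have : psi c * (e / 2) < 0 by rewrite pmulr_llt0.
by lra.
Unshelve. all: by end_near. Qed.

End minimum_tests.

Lemma is_derive_line {R : realType} {V : normedModType R} {f : V -> R}
    {v z : V} {h : R} : differentiable f (h *: v + z) ->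
  is_derive h 1 (fun k : R => f (k *: v + z)) ('D_v f (h *: v + z)).
Proof.
move=> df.
have E : (fun k : R => k^-1 *: (((fun k => f (k *: v + z)) \o shift h) (k *: 1)
      - f (h *: v + z))) =
    (fun k : R => k^-1 *: ((f \o shift (h *: v + z)) (k *: v) - f (h *: v + z))).
  by apply/funext => k /=; rewrite [k%:A]mulr1 scalerDl addrA.
split; last by rewrite /derive E.
by rewrite /derivable E; exact: (@diff_derivable _ _ _ f _ v df).
Qed.

Section barrier.
Context {R : realType} {d : nat}.
Implicit Types (f : 'rV[R]_d * R -> R) (b : R -> R).

Definition open_spacetime : set ('rV[R]_d * R) := [set z | 0 < z.2].

Lemma open_open_spacetime : open open_spacetime.
Proof.
by apply: (open_comp _ (@open_gt _ 0)) => z _; exact: cvg_snd.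
Qed.

(** A minimum principle whose barrier depends on time alone.  A first contact of
    [f] with [b] is a minimum of [f] in space and, going back in time, of
    [f - b]: this gives the signs in the hypothesis to be refuted, which is where
    a differential inequality for [f] enters. *)
Lemma barrier_principle {f b} (b' : R -> R) (K : set 'rV[R]_d) (T : R) :
  compact K -> continuous (f \o clamp_time) -> class_C 2 open_spacetime f ->
  (forall t : R, is_derive t 1 b (b' t)) ->
  (forall x, b 0 < f (x, 0)) ->
  (forall x t, ~ K x -> 0 <= t -> t <= T -> b t < f (x, t)) ->
  (forall z, K z.1 -> 0 < z.2 -> z.2 <= T -> f z = b z.2 ->
    (forall i, dx i f z = 0) -> 0 <= laplacian f z -> dt f z <= b' z.2 ->
    False) ->
  forall x t, 0 <= t -> t <= T -> b t < f (x, t).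
Proof.
move=> cK cf Cf db b0 bK nocontact x1 t1 t10 t1T; rewrite ltNge; apply/negP => fb1.
have cb : continuous b.
  move=> t; apply: differentiable_continuous; apply/derivable1_diffP.
  by have [] := db t.
have [|x [t [t0 tT Kx fb bmin]]] := first_contact cK cf cb b0 bK.
  by exists x1, t1.
have [df Cdf] := Cf.
have zt : open_spacetime (x, t) by [].
have dx0 i : dx i f (x, t) = 0 /\ 0 <= dx i (dx i f) (x, t).
  pose v : 'rV[R]_d * R := (delta_mx 0 i, 0).
  have vt (h : R) : (h *: v + (x, t)).2 = t by rewrite /= scaler0 add0r.
  have vin (h : R) : open_spacetime (h *: v + (x, t)).
    by rewrite /open_spacetime /mkset vt.
  have v0 : 0 *: v + (x, t) = (x, t) by rewrite scale0r add0r.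
  have [_ D0] : is_derive (0 : R) 1 (fun h : R => 'D_v f (h *: v + (x, t)))
      ('D_v ('D_v f) (0 *: v + (x, t))).
    by apply: is_derive_line; apply: (Cdf v).1; rewrite v0.
  have [||h|p0 p1] := @second_derivative_ge0 R (fun h : R => f (h *: v + (x, t)))
      (fun h : R => 'D_v f (h *: v + (x, t))).
  - by move=> h; apply: is_derive_line; exact: df.
  - have [|//] := @is_derive_line _ _ ('D_v f) v (x, t) 0.
    by apply: (Cdf v).1; rewrite v0.
  - rewrite v0 fb; have := bmin (h *: v + (x, t)).1 t (ltW t0) (lexx t).
    by rewrite -[X in f (_, X)](vt h) -surjective_pairing.
  - by rewrite v0 in p0; rewrite D0 v0 in p1; exact: (conj p0 p1).
apply: (nocontact (x, t)) => //.
- by move=> i; exact: (dx0 i).1.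
- by apply: sumr_ge0 => i _; exact: (dx0 i).2.
pose v : 'rV[R]_d * R := (0, 1).
have vE (s : R) : s *: v + (x, 0) = (x, s).
  by congr pair; rewrite /= ?scaler0 ?add0r// addr0 [s%:A]mulr1.
have dfs : is_derive t 1 (fun s : R => f (x, s)) (dt f (x, t)).
  have [|] := @is_derive_line _ _ f v (x, 0) t; rewrite vE; first exact: df.
  by under eq_fun do rewrite vE.
have dw := is_deriveB dfs (db t).
have [dw1 E] := dw.
rewrite -subr_le0 -E; apply: (@derive1_le0_at_left _ _ 0 t) => // s s0 st.
by rewrite !fctE fb subrr subr_ge0; exact: bmin.
Qed.

End barrier.

(** * Conservative and convective operators *)

Section operator_definitions.
Context {R : realType} {d : nat}.
Implicit Types (f g r : 'rV[R]_d * R -> R) (u : 'rV[R]_d * R -> 'rV[R]_d).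
Implicit Types (z : 'rV[R]_d * R) (eps : R).

Definition grad_dot f g z : R := \sum_i dx i f z * dx i g z.

Definition advection u f z : R := \sum_i vcomp u i z * dx i f z.

(** The conservative form: the terms in [u] add up to [div (f u)]. *)
Definition balance eps u f z : R :=
  dt f z + f z * divergence u z + advection u f z - eps * laplacian f z.

(** The convective form: the derivative of [f] along the flow minus the
    regularization that [f] undergoes as a quantity per unit mass. *)
Definition transport eps r u f z : R :=
  dt f z + advection u f z
  - eps * (laplacian f z + 2 / r z * grad_dot r f z).

End operator_definitions.

(* In the polynomial identities below the derivatives are atoms.  Generalizing
   them keeps [ring] and [lra] from comparing two of them by unfolding limits. *)
Ltac abstract_atoms :=
  repeat match goal with
  | |- context [@laplacian ?R ?d ?f ?z] => generalize (@laplacian R d f z); intro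
  | |- context [@divergence ?R ?d ?f ?z] => generalize (@divergence R d f z); intro
  | |- context [@grad_dot ?R ?d ?f ?g ?z] => generalize (@grad_dot R d f g z); intro
  | |- context [@advection ?R ?d ?f ?g ?z] => generalize (@advection R d f g z); intro
  | |- context [@transport ?R ?d ?e ?r ?u ?f ?z] =>
      generalize (@transport R d e r u f z); intro
  | |- context [@balance ?R ?d ?e ?u ?f ?z] =>
      generalize (@balance R d e u f z); intro
  | |- context [@partial1 ?R ?f ?z] => generalize (@partial1 R f z); intro
  | |- context [@partial2 ?R ?f ?z] => generalize (@partial2 R f z); intro
  | |- context [@dx ?R ?d ?i ?f ?z] => generalize (@dx R d i f z); intro
  | |- context [@dt ?R ?d ?f ?z] => generalize (@dt R d f z); intro
  | |- context [@derive ?K ?V ?W ?f ?z ?v] =>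
      generalize (@derive K V W f z v); intro
  end.
Ltac ring_atoms := abstract_atoms; ring.

Section quadratic_form.
Context {R : realType}.

Definition hessian_form (F : R * R -> R) (q w : R * R) : R :=
  let r : 'rV[R]_2 := \row_k (if k == 0 then w.1 else w.2) in
  (r *m hessian F q *m r^T) 0 0.

Lemma hessian_formE (F : R * R -> R) q w : hessian_form F q w =
  partial1 (partial1 F) q * w.1 ^+ 2
  + (partial1 (partial2 F) q + partial2 (partial1 F) q) * (w.1 * w.2)
  + partial2 (partial2 F) q * w.2 ^+ 2.
Proof.
rewrite /hessian_form /hessian !(mxE, big_ord_recl, big_ord0) /=.
by ring_atoms.
Qed.

Lemma hessian_form_ge0 (F : R * R -> R) q w :
  pos_def (hessian F q) -> 0 <= hessian_form F q w.
Proof.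
rewrite /hessian_form => H; set r := (\row_k _ : 'rV[R]_2).
have [->|r0] := eqVneq r 0; last exact/ltW/H.
by rewrite !mul0mx mxE.
Qed.

End quadratic_form.

Section operators.
Context {R : realType} {d : nat}.
Implicit Types (f g r : 'rV[R]_d * R -> R) (u a : 'rV[R]_d * R -> 'rV[R]_d).
Implicit Types (z : 'rV[R]_d * R) (eps : R).

Context {A : set ('rV[R]_d * R)} (oA : open A).

Lemma dx_diff {k i f z} : class_C k.+2 A f -> A z -> differentiable (dx i f) z.
Proof. by move=> /= Cf Az; exact: (Cf.2 _).1. Qed.

Lemma laplacianM {f g z} : class_C 2 A f -> class_C 2 A g -> A z ->
  laplacian (fun y => f y * g y) z
  = f z * laplacian g z + g z * laplacian f z + 2 * grad_dot f g z.
Proof.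
move=> Cf Cg Az.
rewrite /laplacian /grad_dot !mulr_sumr -!big_split/=; apply: eq_bigr => i _.
rewrite [LHS](derive_eq_on (g := fun y => f y * dx i g y + g y * dx i f y) oA _ Az);
  last first.
  move=> y Ay; rewrite /dx deriveM_fun//.
    exact: class_C1_diff Cf Ay.
  exact: class_C1_diff Cg Ay.
have df := class_C1_diff Cf Az; have dg := class_C1_diff Cg Az.
have ddf := @dx_diff _ i _ _ Cf Az; have ddg := @dx_diff _ i _ _ Cg Az.
rewrite deriveD_fun; [|exact: differentiableM|exact: differentiableM].
by rewrite !deriveM_fun// /dx; ring_atoms.
Qed.

Lemma laplacianD {f g z} : class_C 2 A f -> class_C 2 A g -> A z ->
  laplacian (fun y => f y + g y) z = laplacian f z + laplacian g z.
Proof.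
move=> Cf Cg Az; rewrite /laplacian -big_split/=; apply: eq_bigr => i _.
rewrite [LHS](derive_eq_on (g := fun y => dx i f y + dx i g y) oA _ Az); last first.
  move=> y Ay; rewrite /dx deriveD_fun//.
    exact: class_C1_diff Cf Ay.
  exact: class_C1_diff Cg Ay.
by rewrite deriveD_fun//; [exact: dx_diff Cf Az|exact: dx_diff Cg Az].
Qed.

Lemma laplacian_comp2 {O : set (R * R)} {F : R * R -> R} {f g z} :
  (forall y, A y -> O (f y, g y)) -> class_C 2 O F ->
  class_C 2 A f -> class_C 2 A g -> A z ->
  laplacian (fun y => F (f y, g y)) z =
  partial1 F (f z, g z) * laplacian f z + partial2 F (f z, g z) * laplacian g z
  + \sum_i hessian_form F (f z, g z) (dx i f z, dx i g z).
Proof.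
move=> AO CF Cf Cg Az; have Oz := AO _ Az.
rewrite /laplacian !mulr_sumr -!big_split/=; apply: eq_bigr => i _.
rewrite hessian_formE.
rewrite [LHS](derive_eq_on (g := fun y => partial1 F (f y, g y) * dx i f y
    + partial2 F (f y, g y) * dx i g y) oA _ Az); last first.
  move=> y Ay; rewrite /dx derive_comp2//.
  - exact: class_C1_diff Cf Ay.
  - exact: class_C1_diff Cg Ay.
  - exact: class_C1_diff CF (AO _ Ay).
have df := class_C1_diff Cf Az; have dg := class_C1_diff Cg Az.
have dF1 : differentiable (partial1 F) (f z, g z) by exact: (CF.2 _).1.
have dF2 : differentiable (partial2 F) (f z, g z) by exact: (CF.2 _).1.
have C1 : class_C 1 A (fun y => partial1 F (f y, g y)).
  exact: (@class_C_comp2 _ _ 1 _ O (partial1 F) f g oA AO (CF.2 _)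
    (class_CW Cf) (class_CW Cg)).
have C2 : class_C 1 A (fun y => partial2 F (f y, g y)).
  exact: (@class_C_comp2 _ _ 1 _ O (partial2 F) f g oA AO (CF.2 _)
    (class_CW Cf) (class_CW Cg)).
have d1 := class_C1_diff C1 Az; have d2 := class_C1_diff C2 Az.
have ddf := @dx_diff _ i _ _ Cf Az; have ddg := @dx_diff _ i _ _ Cg Az.
rewrite deriveD_fun; [|exact: differentiableM|exact: differentiableM].
by rewrite !deriveM_fun// !derive_comp2// /dx /=; ring_atoms.
Qed.

Lemma advectionM {u f g z} : class_C 2 A f -> class_C 2 A g -> A z ->
  advection u (fun y => f y * g y) z = f z * advection u g z + g z * advection u f z.
Proof.
move=> Cf Cg Az; rewrite /advection !mulr_sumr -big_split/=.
apply: eq_bigr => i _; rewrite /dx deriveM_fun.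
- by ring_atoms.
- exact: class_C1_diff Cf Az.
- exact: class_C1_diff Cg Az.
Qed.

Lemma advectionD {u f g z} : class_C 2 A f -> class_C 2 A g -> A z ->
  advection u (fun y => f y + g y) z = advection u f z + advection u g z.
Proof.
move=> Cf Cg Az; rewrite /advection -big_split/=.
apply: eq_bigr => i _; rewrite /dx deriveD_fun ?mulrDr//.
- exact: class_C1_diff Cf Az.
- exact: class_C1_diff Cg Az.
Qed.

Lemma grad_dotMr {r f g z} : class_C 2 A f -> class_C 2 A g -> A z ->
  grad_dot r (fun y => f y * g y) z = f z * grad_dot r g z + g z * grad_dot r f z.
Proof.
move=> Cf Cg Az; rewrite /grad_dot !mulr_sumr -big_split/=.
apply: eq_bigr => i _; rewrite /dx deriveM_fun.
- by ring_atoms.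
- exact: class_C1_diff Cf Az.
- exact: class_C1_diff Cg Az.
Qed.

Lemma grad_dotDr {r f g z} : class_C 2 A f -> class_C 2 A g -> A z ->
  grad_dot r (fun y => f y + g y) z = grad_dot r f z + grad_dot r g z.
Proof.
move=> Cf Cg Az; rewrite /grad_dot -big_split/=.
apply: eq_bigr => i _; rewrite /dx deriveD_fun ?mulrDr//.
- exact: class_C1_diff Cf Az.
- exact: class_C1_diff Cg Az.
Qed.

(** The cross term [2 grad r . grad f] in the Laplacian of [r f] is the drift of
    [transport]; all other terms regroup. *)
Lemma balanceM {eps u r f z} : class_C 2 A r -> class_C 2 A f -> A z ->
  r z != 0 ->
  balance eps u (fun y => r y * f y) z
  = r z * transport eps r u f z + f z * balance eps u r z.
Proof.
move=> Cr Cf Az r0; rewrite /balance /transport laplacianM// advectionM//.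
rewrite /dt deriveM_fun; first by abstract_atoms; field.
- exact: class_C1_diff Cr Az.
- exact: class_C1_diff Cf Az.
Qed.

Lemma balanceD {eps u f g z} : class_C 2 A f -> class_C 2 A g -> A z ->
  balance eps u (fun y => f y + g y) z = balance eps u f z + balance eps u g z.
Proof.
move=> Cf Cg Az; rewrite /balance laplacianD// advectionD//.
rewrite /dt deriveD_fun; first by ring_atoms.
- exact: class_C1_diff Cf Az.
- exact: class_C1_diff Cg Az.
Qed.

(** Squaring costs [2 eps |grad f|^2], the source of all dissipation terms.  The
    term with [div u] appears since [balance] is not a derivation even without
    regularization. *)
Lemma balance_sqr {eps u f z} : class_C 2 A f -> A z ->
  balance eps u (fun y => f y * f y) z
  = 2 * (f z * balance eps u f z) - f z ^+ 2 * divergence u z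
    - 2 * eps * grad_dot f f z.
Proof.
move=> Cf Az; rewrite /balance laplacianM// advectionM//.
rewrite /dt deriveM_fun; first by ring_atoms.
- exact: class_C1_diff Cf Az.
- exact: class_C1_diff Cf Az.
Qed.

Lemma transportD {eps r u f g z} : class_C 2 A f -> class_C 2 A g -> A z ->
  transport eps r u (fun y => f y + g y) z
  = transport eps r u f z + transport eps r u g z.
Proof.
move=> Cf Cg Az; rewrite /transport laplacianD// advectionD// grad_dotDr//.
rewrite /dt deriveD_fun; first by ring_atoms.
- exact: class_C1_diff Cf Az.
- exact: class_C1_diff Cg Az.
Qed.

Lemma transport_sqr {eps r u f z} : class_C 2 A f -> A z ->
  transport eps r u (fun y => f y * f y) z
  = 2 * (f z * transport eps r u f z) - 2 * eps * grad_dot f f z.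
Proof.
move=> Cf Az; rewrite /transport laplacianM// advectionM// grad_dotMr//.
rewrite /dt deriveM_fun; first by ring_atoms.
- exact: class_C1_diff Cf Az.
- exact: class_C1_diff Cf Az.
Qed.

Lemma transport_comp2 {O : set (R * R)} {F : R * R -> R} {eps r u f g z} :
  (forall y, A y -> O (f y, g y)) -> class_C 2 O F ->
  class_C 2 A f -> class_C 2 A g -> A z ->
  transport eps r u (fun y => F (f y, g y)) z =
  partial1 F (f z, g z) * transport eps r u f z
  + partial2 F (f z, g z) * transport eps r u g z
  - eps * \sum_i hessian_form F (f z, g z) (dx i f z, dx i g z).
Proof.
move=> AO CF Cf Cg Az.
have D1 v : 'D_v (fun y => F (f y, g y)) z =
    partial1 F (f z, g z) * 'D_v f z + partial2 F (f z, g z) * 'D_v g z.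
  apply: derive_comp2.
  - exact: class_C1_diff Cf Az.
  - exact: class_C1_diff Cg Az.
  - exact: class_C1_diff CF (AO _ Az).
have Dsum (c : 'I_d -> R) : \sum_i c i * dx i (fun y => F (f y, g y)) z =
    partial1 F (f z, g z) * (\sum_i c i * dx i f z)
    + partial2 F (f z, g z) * (\sum_i c i * dx i g z).
  rewrite !mulr_sumr -big_split/=; apply: eq_bigr => i _.
  by rewrite /dx D1; ring_atoms.
rewrite /transport (laplacian_comp2 AO)// /advection /grad_dot !Dsum /dt D1.
by ring_atoms.
Qed.

Lemma divergenceZ {f a z} : class_C 2 A f -> (forall j, class_C 2 A (vcomp a j)) ->
  A z ->
  divergence (fun y => f y *: a y) z = f z * divergence a z + advection a f z.
Proof.
move=> Cf Ca Az; rewrite /divergence /advection mulr_sumr -big_split/=.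
apply: eq_bigr => i _.
rewrite [LHS](_ : _ = dx i (fun y => f y * vcomp a i y) z); last first.
  by congr (dx i _ z); apply/funext => y; rewrite /vcomp mxE.
rewrite /dx deriveM_fun//.
  exact: class_C1_diff Cf Az.
exact: class_C1_diff (Ca i) Az.
Qed.

End operators.

(** [balance] and [transport] at a fixed point are additive functionals on
    functions of class C^2; opposites, halves and sums follow from this alone. *)
Section additive_functional.
Context {R : realType} {V : normedModType R} {A : set V} (oA : open A).
Context {L : (V -> R) -> R}.
Hypothesis LD : forall f g, class_C 2 A f -> class_C 2 A g ->
  L (fun y => f y + g y) = L f + L g.

Lemma additive_functional0 : L (fun=> 0) = 0.
Proof.
have := LD _ _ (class_C_cst 0) (class_C_cst 0).
by rewrite (_ : (fun _ => _ + _) = fun=> 0); [lra|apply/funext => y; rewrite addr0].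
Qed.

Lemma additive_functionalN {f : V -> R} : class_C 2 A f -> L (fun y => - f y) = - L f.
Proof.
move=> Cf; have := LD _ _ Cf (class_CN oA Cf).
rewrite (_ : (fun _ => _ + _) = fun=> 0); last by apply/funext => y; rewrite subrr.
by rewrite additive_functional0; lra.
Qed.

Lemma additive_functional_half {f : V -> R} : class_C 2 A f ->
  L (fun y => 2^-1 * f y) = 2^-1 * L f.
Proof.
move=> Cf; have Ch := class_CM oA (class_C_cst 2^-1) Cf.
have := LD _ _ Ch Ch; rewrite (_ : (fun _ => _ + _) = f); first lra.
by apply/funext => y; rewrite -mulrDl; lra.
Qed.

Lemma additive_functional_sum {n} {f : 'I_n -> V -> R} :
  (forall i, class_C 2 A (f i)) ->
  L (fun y => \sum_i f i y) = \sum_i L (f i).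
Proof.
move=> Cf; suff H : forall s : seq 'I_n,
    class_C 2 A (fun y => \sum_(i <- s) f i y) /\
    L (fun y => \sum_(i <- s) f i y) = \sum_(i <- s) L (f i).
  by have [_] := H (index_enum 'I_n).
elim=> [|i s [Cs Ls]].
  rewrite big_nil -[in RHS]additive_functional0.
  rewrite (_ : (fun y => _) = fun=> 0); last by apply/funext => y; rewrite big_nil.
  by split=> //; exact: class_C_cst.
rewrite (_ : (fun y => _) = fun y => f i y + \sum_(j <- s) f j y); last first.
  by apply/funext => y; rewrite big_cons.
by split; [exact: class_CD oA (Cf i) Cs|rewrite big_cons -Ls; exact: LD (Cf i) Cs].
Qed.

End additive_functional.

Section operators_congruence.
Context {R : realType} {d : nat} {A : set ('rV[R]_d * R)} (oA : open A).
Implicit Types (f g r : 'rV[R]_d * R -> R) (u a : 'rV[R]_d * R -> 'rV[R]_d).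

Lemma laplacian_eq_on {f g z} : (forall y, A y -> f y = g y) -> A z ->
  laplacian f z = laplacian g z.
Proof.
move=> fg Az; apply: eq_bigr => i _; apply: (derive_eq_on oA) => // y Ay.
exact: (derive_eq_on oA fg Ay).
Qed.

Lemma grad_dot_eq_on {r f g z} : (forall y, A y -> f y = g y) -> A z ->
  grad_dot r f z = grad_dot r g z.
Proof.
move=> fg Az; apply: eq_bigr => i _; congr (_ * _); exact: derive_eq_on oA fg Az.
Qed.

Lemma advection_eq_on {u f g z} : (forall y, A y -> f y = g y) -> A z ->
  advection u f z = advection u g z.
Proof.
move=> fg Az; apply: eq_bigr => i _; congr (_ * _); exact: derive_eq_on oA fg Az.
Qed.

Lemma dt_eq_on {f g z} : (forall y, A y -> f y = g y) -> A z -> dt f z = dt g z.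
Proof. by move=> fg Az; exact: derive_eq_on oA fg Az. Qed.

Lemma balance_eq_on {eps u f g z} : (forall y, A y -> f y = g y) -> A z ->
  balance eps u f z = balance eps u g z.
Proof.
move=> fg Az; rewrite /balance (laplacian_eq_on fg Az) (dt_eq_on fg Az).
by rewrite (advection_eq_on fg Az) fg.
Qed.

Lemma transport_eq_on {eps r u f g z} : (forall y, A y -> f y = g y) -> A z ->
  transport eps r u f z = transport eps r u g z.
Proof.
move=> fg Az; rewrite /transport (laplacian_eq_on fg Az) (dt_eq_on fg Az).
by rewrite (advection_eq_on fg Az) (grad_dot_eq_on fg Az).
Qed.

Lemma balance_cst {eps u c z} : balance eps u (fun=> c) z = c * divergence u z.
Proof.
have D0 (v y : 'rV[R]_d * R) e : 'D_v (fun=> e : R) y = 0 by exact: derive_cst.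
have dx0 e i : dx i (fun=> e : R) = fun=> 0 :> R.
  by apply/funext => y; exact: D0.
rewrite /balance /laplacian /advection /dt D0.
rewrite big1; last by move=> i _; rewrite dx0 mulr0.
rewrite big1; last by move=> i _; rewrite !dx0.
by rewrite add0r addr0 mulr0 subr0.
Qed.

Lemma class_C_sqnorm {k a} : (forall j, class_C k A (vcomp a j)) ->
  class_C k A (fun y => dot (a y) (a y)).
Proof. by move=> Ca; apply: class_C_sum => // j; exact: class_CM (Ca j) (Ca j). Qed.

Lemma balance_half_sqnorm {eps u a z} : (forall j, class_C 2 A (vcomp a j)) ->
  A z ->
  balance eps u (fun y => 2^-1 * dot (a y) (a y)) z
  = \sum_j vcomp a j z * balance eps u (vcomp a j) z
    - 2^-1 * dot (a z) (a z) * divergence u z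
    - eps * \sum_j grad_dot (vcomp a j) (vcomp a j) z.
Proof.
move=> Ca Az.
have LD f g : class_C 2 A f -> class_C 2 A g -> balance eps u (fun y => f y + g y) z
    = balance eps u f z + balance eps u g z by move=> Cf Cg; exact: (balanceD oA Cf Cg Az).
rewrite (additive_functional_half oA LD (class_C_sqnorm Ca)).
rewrite (additive_functional_sum oA LD) => [|j]; last exact: class_CM (Ca j) (Ca j).
have -> : 2^-1 * dot (a z) (a z) * divergence u z
    = \sum_j 2^-1 * (vcomp a j z * vcomp a j z) * divergence u z.
  by rewrite -mulr_suml -mulr_sumr.
rewrite !mulr_sumr -!sumrB; apply: eq_bigr => j _.
by rewrite (balance_sqr oA (Ca j) Az); abstract_atoms; field.
Qed.

Lemma transport_half_sqnorm {eps r u a z} : (forall j, class_C 2 A (vcomp a j)) ->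
  A z ->
  transport eps r u (fun y => 2^-1 * dot (a y) (a y)) z
  = \sum_j vcomp a j z * transport eps r u (vcomp a j) z
    - eps * \sum_j grad_dot (vcomp a j) (vcomp a j) z.
Proof.
move=> Ca Az.
have LD f g : class_C 2 A f -> class_C 2 A g ->
    transport eps r u (fun y => f y + g y) z
    = transport eps r u f z + transport eps r u g z.
  by move=> Cf Cg; exact: (transportD oA Cf Cg Az).
rewrite (additive_functional_half oA LD (class_C_sqnorm Ca)).
rewrite (additive_functional_sum oA LD) => [|j]; last exact: class_CM (Ca j) (Ca j).
rewrite !mulr_sumr -!sumrB; apply: eq_bigr => j _.
by rewrite (transport_sqr oA (Ca j) Az); abstract_atoms; field.
Qed.

Lemma outerE (x y : 'rV[R]_d) i j :
  outer x y i j = x 0 i * y 0 j.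
Proof. by rewrite /outer mxE big_ord1 mxE. Qed.

Lemma maxwell_stressE (B : 'rV[R]_d * R -> 'rV[R]_d) i j :
  (fun y => maxwell_stress B y i j) =
  (fun y => - (2^-1 * dot (B y) (B y)) * (i == j)%:R + vcomp B i y * vcomp B j y).
Proof.
apply/funext => y; rewrite /maxwell_stress /outer !mxE big_ord1 !mxE /vcomp.
by case: (i == j); rewrite /= ?mulr1n ?mulr0n ?mulr1 ?mulr0 ?oppr0.
Qed.

(** The product rule gives the work of the stress divergence and, by symmetry of
    the stress, its contraction with [grad u].  In the latter the rank-one part
    [B B] yields [B . (B . grad) u], the isotropic part the work of the magnetic
    pressure. *)
Lemma maxwell_stress_work {u B} {z} : (forall j, class_C 2 A (vcomp u j)) ->
  (forall j, class_C 2 A (vcomp B j)) -> A z ->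
  divergence (fun y => u y *m maxwell_stress B y) z
  = \sum_j vcomp u j z * mx_divergence (maxwell_stress B) j z
    + \sum_j vcomp B j z * advection B (vcomp u j) z
    - 2^-1 * dot (B z) (B z) * divergence u z.
Proof.
move=> Cu CB Az.
have Cbeta i j : class_C 2 A (fun y => maxwell_stress B y i j).
  rewrite maxwell_stressE; apply: class_CD => //; last exact: class_CM.
  apply: class_CM => //; last exact: class_C_cst.
  apply: class_CN => //; apply: class_CM => //; first exact: class_C_cst.
  exact: class_C_sqnorm.
have beta_sym i j : (fun y => maxwell_stress B y i j) = (fun y => maxwell_stress B y j i).
  by rewrite !maxwell_stressE eq_sym; apply/funext => y; rewrite [vcomp B i y * _]mulrC.
have dbeta i j : differentiable (fun y => maxwell_stress B y i j) z.
  exact: class_C1_diff (Cbeta i j) Az.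
have du j : differentiable (vcomp u j) z by exact: class_C1_diff (Cu j) Az.
transitivity (\sum_i \sum_j (vcomp u j z * dx i (fun y => maxwell_stress B y i j) z
    + maxwell_stress B z i j * dx i (vcomp u j) z)).
  apply: eq_bigr => i _.
  rewrite [LHS](_ : _ = dx i (fun y => \sum_j vcomp u j y * maxwell_stress B y i j) z).
    rewrite /dx derive_sum_fun; last by move=> j; exact: differentiableM.
    by apply: eq_bigr => j _; rewrite deriveM_fun.
  congr (dx i _ z); apply/funext => y; rewrite /vcomp mxE; apply: eq_bigr => j _.
  by rewrite (congr1 (fun f => f y) (beta_sym i j)).
have -> : 2^-1 * dot (B z) (B z) * divergence u z
    = \sum_j 2^-1 * dot (B z) (B z) * dx j (vcomp u j) z by rewrite -mulr_sumr.
rewrite exchange_big -big_split -sumrB /=.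
apply: eq_bigr => j _; rewrite big_split /= -addrA; congr (_ + _).
  by rewrite /mx_divergence mulr_sumr.
rewrite /advection mulr_sumr.
rewrite (eq_bigr (fun i => vcomp B j z * (vcomp B i z * dx i (vcomp u j) z)
    - 2^-1 * dot (B z) (B z) * (i == j)%:R * dx i (vcomp u j) z)); last first.
  move=> i _; rewrite (congr1 (fun f => f z) (maxwell_stressE B i j)).
  by move: (dx i _ z) => x; ring.
rewrite sumrB; congr (_ - _).
rewrite (bigD1 j)//= eqxx big1 ?addr0 ?mulr1// => i /negbTE ->.
by rewrite mulr0 mul0r.
Qed.

End operators_congruence.

(** * Entropy production *)

Section linear_functionals.
Context {R : realType} {V : normedModType R}.

Lemma derive_linear (f : {linear V -> R}) : continuous f ->
  forall v x, 'D_v f x = f v.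
Proof.
move=> cf v x; rewrite deriveE; last exact: linear_differentiable.
by rewrite diff_lin.
Qed.

Lemma class_C_linear k (A : set V) (f : {linear V -> R}) :
  continuous f -> class_C k A f.
Proof.
move=> cf; case: k => [x _|k]; first exact: cf.
split=> [x _|v]; first exact: linear_differentiable.
rewrite (_ : 'D_v f = fun=> f v); first exact: class_C_cst.
by apply/funext => x; exact: derive_linear.
Qed.

End linear_functionals.

Section projections.
Context {R : realType}.

Let fst_linear : linear (@fst R R). Proof. by []. Qed.
Let snd_linear : linear (@snd R R). Proof. by []. Qed.
HB.instance Definition _ :=
  GRing.isLinear.Build R (R * R)%type R *%R (@fst R R) fst_linear.
HB.instance Definition _ :=
  GRing.isLinear.Build R (R * R)%type R *%R (@snd R R) snd_linear.

Let fst_continuous : continuous (@fst R R). Proof. by move=> z; exact: cvg_fst. Qed.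
Let snd_continuous : continuous (@snd R R). Proof. by move=> z; exact: cvg_snd. Qed.

Lemma derive_fst (v q : R * R) : 'D_v (fst : R * R -> R) q = v.1.
Proof. exact: derive_linear fst_continuous v q. Qed.

Lemma class_C_fst k (A : set (R * R)) : class_C k A (fst : R * R -> R).
Proof. exact: class_C_linear fst_continuous. Qed.

Lemma derive_snd (v q : R * R) : 'D_v (snd : R * R -> R) q = v.2.
Proof. exact: derive_linear snd_continuous v q. Qed.

Lemma class_C_snd k (A : set (R * R)) : class_C k A (snd : R * R -> R).
Proof. exact: class_C_linear snd_continuous. Qed.

End projections.

(** [- s] as a function of the specific volume and the internal energy, the
    variables in which it is convex. *)
Definition neg_entropy_of_volume {R : realType} (s : R * R -> R) (q : R * R) : R :=
  - s (q.1^-1, q.2).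

Section thermodynamic_functions.
Context {R : realType} {Ie : set R} {s p : R * R -> R}.
Hypothesis thermo : entropy_pressure Ie s p.

Lemma open_states : open (states Ie).
Proof.
apply: openI; first by apply: (open_comp _ (@open_gt _ 0)) => z _; exact: cvg_fst.
by apply: (open_comp _ (admissible_open thermo)) => z _; exact: cvg_snd.
Qed.

Lemma states_inv q : states Ie q -> states Ie (q.1^-1, q.2).
Proof. by move=> [q1 q2]; split=> //=; rewrite invr_gt0. Qed.

Lemma class_C_inv_fst k : class_C k (states Ie) (fun q : R * R => q.1^-1).
Proof.
apply: class_C_inv (class_C_fst _ _); first exact: open_states.
by move=> y [y1 _]; rewrite gt_eqF.
Qed.

Let g := neg_entropy_of_volume s.

Lemma class_C_neg_entropy k : class_C k (states Ie) g.
Proof.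
apply: class_CN; first exact: open_states.
exact: (class_C_comp2 open_states states_inv (entropy_smooth thermo k) (class_C_inv_fst k)
  (class_C_snd _ _)).
Qed.

Lemma derive_neg_entropy v q : states Ie q ->
  'D_v g q = q.1 ^- 2 * partial1 s (q.1^-1, q.2) * v.1
             - partial2 s (q.1^-1, q.2) * v.2.
Proof.
move=> Sq; have q0 : q.1 != 0 by rewrite gt_eqF//; exact: Sq.1.
have Cinv := class_C_inv_fst 1.
have dinv := class_C1_diff Cinv Sq.
have dsnd := class_C1_diff (class_C_snd 1 (states Ie)) Sq.
have ds : differentiable s (q.1^-1, q.2).
  exact: class_C1_diff (entropy_smooth thermo 1) (states_inv _ Sq).
have Dinv : 'D_v (fun q : R * R => q.1^-1) q = - q.1 ^- 2 * v.1.
  rewrite (@deriveV _ _ fst)// ?derive_fst//.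
  by apply: diff_derivable; exact: class_C1_diff (class_C_fst 1 _) Sq.
have sinv : differentiable (fun q : R * R => s (q.1^-1, q.2)) q.
  exact: class_C1_diff (class_C_comp2 open_states states_inv (entropy_smooth thermo 1)
    Cinv (class_C_snd 1 _)) Sq.
rewrite /g /neg_entropy_of_volume.
rewrite [LHS](@deriveN _ _ _ (fun q : R * R => s (q.1^-1, q.2)) q v);
  last exact: diff_derivable.
have -> : 'D_v (fun q : R * R => s (q.1^-1, q.2)) q
    = partial1 s (q.1^-1, q.2) * (- q.1 ^- 2 * v.1) + partial2 s (q.1^-1, q.2) * v.2.
  by rewrite -Dinv -(derive_snd v q); exact: derive_comp2 dinv dsnd ds.
by abstract_atoms; ring.
Qed.

End thermodynamic_functions.

Section entropy_production.
Context {R : realType} {d : nat}.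
Context {A : set ('rV[R]_d * R)} (oA : open A).
Context {eps : R} {r e P : 'rV[R]_d * R -> R} {u B : 'rV[R]_d * R -> 'rV[R]_d}.
Hypothesis Cr : class_C 2 A r.
Hypothesis Ce : class_C 2 A e.
Hypothesis Cu : forall j, class_C 2 A (vcomp u j).
Hypothesis CB : forall j, class_C 2 A (vcomp B j).
Hypothesis r_gt0 : forall z, A z -> 0 < r z.
Context {z : 'rV[R]_d * R} (Az : A z).
Hypothesis mass : balance eps u r z = 0.

Let rz0 : r z != 0. Proof. by rewrite gt_eqF// r_gt0. Qed.

(** [r * r^-1] is the constant [1], whose balance is [div u]. *)
Lemma transport_volume :
  r z * transport eps r u (fun y => (r y)^-1) z = divergence u z.
Proof.
have CV : class_C 2 A (fun y => (r y)^-1).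
  by apply: class_C_inv => // y Ay; rewrite gt_eqF// r_gt0.
have := @balanceM _ _ _ oA eps u _ _ _ Cr CV Az rz0.
rewrite mass mulr0 addr0 => <-.
rewrite (balance_eq_on oA (g := fun=> 1) _ Az) ?balance_cst ?mul1r//.
by move=> y Ay; rewrite divff// gt_eqF// r_gt0.
Qed.

Definition dissipation z : R :=
  r z * (\sum_j grad_dot (vcomp u j) (vcomp u j) z)
  + \sum_j grad_dot (vcomp B j) (vcomp B j) z.

(** Expand the balance of the total energy.  The momentum law turns the kinetic
    part into the work of [grad P] and of the Maxwell stress; the induction law
    turns the magnetic part into [B . (B . grad) u] minus the work of the
    magnetic pressure.  By [maxwell_stress_work] all of this cancels against the
    energy flux, up to the compression work [P div u]. *)
Lemma transport_internal_energy :
  (forall j, balance eps u (fun y => r y * vcomp u j y) z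
     = - dx j P z + mx_divergence (maxwell_stress B) j z) ->
  (forall j, balance eps u (vcomp B j) z = advection B (vcomp u j) z) ->
  balance eps u (fun y => r y * (e y + 2^-1 * dot (u y) (u y))
                          + 2^-1 * dot (B y) (B y)) z
    = - (P z * divergence u z + advection u P z)
      + divergence (fun y => u y *m maxwell_stress B y) z ->
  r z * transport eps r u e z = - P z * divergence u z + eps * dissipation z.
Proof.
move=> momentum induction.
have Cuu := class_C_sqnorm oA Cu; have CBB := class_C_sqnorm oA CB.
have Ch (f : 'rV[R]_d * R -> R) : class_C 2 A f -> class_C 2 A (fun y => 2^-1 * f y).
  exact: class_CM oA (class_C_cst 2^-1).
have Ck := class_CD oA Ce (Ch _ Cuu).
rewrite (balanceD oA (class_CM oA Cr Ck) (Ch _ CBB) Az).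
rewrite (balanceM oA Cr Ck Az rz0) mass mulr0 addr0.
rewrite (transportD oA Ce (Ch _ Cuu) Az).
rewrite (transport_half_sqnorm oA Cu Az) (balance_half_sqnorm oA CB Az).
rewrite (maxwell_stress_work oA Cu CB Az).
have -> : \sum_j vcomp B j z * balance eps u (vcomp B j) z
    = \sum_j vcomp B j z * advection B (vcomp u j) z.
  by apply: eq_bigr => j _; rewrite induction.
have : r z * (\sum_j vcomp u j z * transport eps r u (vcomp u j) z)
    = - advection u P z + \sum_j vcomp u j z * mx_divergence (maxwell_stress B) j z.
  rewrite /advection mulr_sumr -sumrN -big_split/=; apply: eq_bigr => j _.
  have := momentum j; rewrite (balanceM oA Cr (Cu j) Az rz0) mass mulr0 addr0.
  by move=> E; rewrite mulrCA E mulrDr mulrN.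
rewrite /dissipation.
move: (\sum_j vcomp u j z * mx_divergence _ _ _) (\sum_j vcomp B j z * _).
move: (\sum_j vcomp u j z * _) (\sum_j grad_dot (vcomp u j) _ z).
move: (\sum_j grad_dot _ _ _) (dot _ _).
abstract_atoms; move=> *; lra.
Qed.

(** By the chain rule for [- s] in the variables [(r^-1, e)], [r] times the
    transport of [- s] is [div u (r^2 s_r + P s_e)], zero by the equation of
    state, minus [eps (s_e * dissipation + r * Hessian form)]. *)
Lemma transport_entropy_ge0 {Ie : set R} {s p : R * R -> R} :
  entropy_pressure Ie s p -> 0 <= eps ->
  (forall y, A y -> Ie (e y)) -> P z = p (r z, e z) ->
  r z * transport eps r u e z = - P z * divergence u z + eps * dissipation z ->
  0 <= transport eps r u (fun y => s (r y, e y)) z.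
Proof.
move=> thermo eps0 Iee Pz energy.
have Sre y : A y -> states Ie (r y, e y) by move=> Ay; split; [exact: r_gt0|exact: Iee].
have Sve y : A y -> states Ie ((r y)^-1, e y).
  by move=> Ay; exact: (states_inv (r y, e y) (Sre y Ay)).
have CV : class_C 2 A (fun y => (r y)^-1).
  by apply: class_C_inv => // y Ay; rewrite gt_eqF// r_gt0.
have CS := class_C_comp2 oA Sre (entropy_smooth thermo 2) Cr Ce.
have TD (f h : 'rV[R]_d * R -> R) : class_C 2 A f -> class_C 2 A h ->
    transport eps r u (fun y => f y + h y) z
    = transport eps r u f z + transport eps r u h z.
  by move=> Cf Ch; exact: (transportD oA Cf Ch Az).
rewrite -oppr_le0 -(additive_functionalN oA TD CS).
have vol y : A y -> - s (r y, e y) = neg_entropy_of_volume s ((r y)^-1, e y).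
  by move=> Ay; rewrite /neg_entropy_of_volume /= invrK.
rewrite (transport_eq_on oA vol Az).
rewrite (transport_comp2 oA Sve (class_C_neg_entropy thermo 2) CV Ce Az).
have q0 := Sve z Az.
have -> : partial1 (neg_entropy_of_volume s) ((r z)^-1, e z)
    = r z ^+ 2 * partial1 s (r z, e z).
  apply: etrans (derive_neg_entropy thermo (1, 0) _ q0) _.
  by rewrite /= -exprVn invrK; abstract_atoms; ring.
have -> : partial2 (neg_entropy_of_volume s) ((r z)^-1, e z) = - partial2 s (r z, e z).
  apply: etrans (derive_neg_entropy thermo (0, 1) _ q0) _.
  by rewrite /= invrK; abstract_atoms; ring.
have hess : 0 <= \sum_i hessian_form (neg_entropy_of_volume s) ((r z)^-1, e z)
    (dx i (fun y => (r y)^-1) z, dx i e z).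
  apply: sumr_ge0 => i _; apply: hessian_form_ge0.
  exact: (entropy_convex thermo (q := (r z, e z)) (Sre z Az)).
have T0 := temperature_gt0 thermo (Sre z Az).
have := equation_of_state thermo (Sre z Az).
have grad2 (a : 'rV[R]_d * R -> 'rV[R]_d) :
    0 <= \sum_j grad_dot (vcomp a j) (vcomp a j) z.
  by apply: sumr_ge0 => j _; apply: sumr_ge0 => i _; rewrite -expr2 sqr_ge0.
have diss : 0 <= dissipation z.
  exact: addr_ge0 (mulr_ge0 (ltW (r_gt0 _ Az)) (grad2 u)) (grad2 B).
rewrite -Pz /= => eos.
rewrite -(pmulr_rle0 _ (r_gt0 _ Az)).
move: T0 energy transport_volume hess eos; set H := \sum_i _; clearbody H.
set Te := transport _ _ _ e z; set Tv := transport _ _ _ _ z; set div_u := divergence u z.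
clearbody Te Tv div_u.
set s_rho := partial1 s _; set s_e := partial2 s _; clearbody s_rho s_e.
move: (dissipation z) diss (r z) (r_gt0 _ Az) (P z) => D D0 rho rho0 pz.
move=> s_e0 eTe eTv H0 eos.
have -> : rho * (rho ^+ 2 * s_rho * Tv + - s_e * Te - eps * H)
    = div_u * (pz * s_e + rho ^+ 2 * s_rho) - eps * (s_e * D + rho * H).
  have -> : rho * (rho ^+ 2 * s_rho * Tv + - s_e * Te - eps * H)
    = rho ^+ 2 * s_rho * (rho * Tv) - s_e * (rho * Te) - eps * (rho * H) by ring.
  by rewrite eTv eTe; ring.
rewrite eos mulr0 sub0r oppr_le0 mulr_ge0//.
by rewrite addr_ge0// mulr_ge0// ltW.
Qed.

End entropy_production.

(** * The regularized MHD system *)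

Section smooth_fields.
Context {R : realType} {d : nat}.
Implicit Types (f : 'rV[R]_d * R -> R).

Lemma smooth_field_class_C k {f} : smooth_field f -> class_C k open_spacetime f.
Proof.
move=> [U [F [oU hU CF Ff]]].
have sub : open_spacetime `<=` (half_spacetime : set ('rV[R]_d * R)).
  by move=> z; exact: ltW.
have CF' : class_C k open_spacetime F.
  by apply: class_C_subset (CF k) => z /sub /hU.
by apply: (class_C_eq open_open_spacetime _ CF') => z /sub; exact: Ff.
Qed.

(** The extension is what bounds [dx i f] on compact sets reaching time zero: it
    has the same spatial derivatives at positive times, and its own are
    continuous up to time zero. *)
Lemma smooth_field_extension {f} : smooth_field f ->
  exists (U : set ('rV[R]_d * R)) (F : 'rV[R]_d * R -> R),
    [/\ forall z, U (clamp_time z), class_Cinfty U F,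
        f \o clamp_time = F \o clamp_time &
        forall i z, open_spacetime z -> dx i f z = dx i F z].
Proof.
move=> [U [F [oU hU CF Ff]]]; exists U, F; split=> //.
- by move=> z; apply: hU; exact: clamp_time_ge0.
- by apply/funext => z /=; rewrite Ff//; exact: clamp_time_ge0.
- move=> i z z0; apply/esym/(derive_eq_on open_open_spacetime _ z0) => y /ltW.
  exact: Ff.
Qed.

Lemma continuous_on_clamp_time {U : set ('rV[R]_d * R)} {F : 'rV[R]_d * R -> R} :
  (forall z, U (clamp_time z)) -> class_C 0 U F -> continuous (F \o clamp_time).
Proof.
move=> hU CF z; apply: continuous_comp; first exact: continuous_clamp_time.
exact: CF (hU z).
Qed.

Lemma smooth_field_continuous {f} : smooth_field f -> continuous (f \o clamp_time).
Proof.
move=> /smooth_field_extension[U [F [hU CF -> _]]].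
exact: continuous_on_clamp_time hU (CF 0).
Qed.

End smooth_fields.

(** Stated along an arbitrary map [phi] so that it gives both the smoothness of
    [e] for positive times ([phi] the identity) and its continuity up to time
    zero ([phi] the clamping of time). *)
Lemma class_C_internal_energy {R : realType} {d : nat} {V : normedModType R}
    {k} {A : set V} {phi : V -> 'rV[R]_d * R} {rho E : 'rV[R]_d * R -> R}
    {m B : 'rV[R]_d * R -> 'rV[R]_d} : open A ->
  (forall y, A y -> rho (phi y) != 0) ->
  class_C k A (rho \o phi) -> class_C k A (E \o phi) ->
  (forall j, class_C k A (vcomp (velocity rho m) j \o phi)) ->
  (forall j, class_C k A (vcomp B j \o phi)) ->
  class_C k A (internal_energy rho m E B \o phi).
Proof.
move=> oA r0 Cr CE Cu CB.
have Ch (f : V -> R) : class_C k A f -> class_C k A (fun y => 2^-1 * f y).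
  exact: class_CM oA (class_C_cst 2^-1).
have Csq (a : 'rV[R]_d * R -> 'rV[R]_d) : (forall j, class_C k A (vcomp a j \o phi)) ->
    class_C k A (fun y => dot (a (phi y)) (a (phi y))).
  by move=> Ca; apply: class_C_sum => // j; exact: class_CM oA (Ca j) (Ca j).
have Cnum := class_CD oA (class_CD oA CE (class_CN oA (class_CM oA (Ch _ Cr) (Csq _ Cu))))
  (class_CN oA (Ch _ (Csq _ CB))).
exact: class_CM oA Cnum (class_C_inv oA r0 Cr).
Qed.

Section conservation_laws.
Context {R : realType} {d : nat} {Ie : set R} {s p : R * R -> R} {eps : R}.
Context {rho E : 'rV[R]_d * R -> R} {m B : 'rV[R]_d * R -> 'rV[R]_d}.
Hypothesis sol : smooth_mhd_solution Ie p eps rho m E B.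

Let A : set ('rV[R]_d * R) := open_spacetime.
Let oA : open A := open_open_spacetime.
Let u := velocity rho m.
Let e := internal_energy rho m E B.
Let P z := p (rho z, e z).

Let Cr : class_C 2 A rho := smooth_field_class_C 2 (density_smooth sol).
Let CE : class_C 2 A E := smooth_field_class_C 2 (energy_smooth sol).
Let Cu j : class_C 2 A (vcomp u j) := smooth_field_class_C 2 (velocity_smooth sol j).
Let CB j : class_C 2 A (vcomp B j) := smooth_field_class_C 2 (magnetic_smooth sol j).

Lemma momentumE j z : rho z != 0 -> vcomp m j z = rho z * vcomp u j z.
Proof. by move=> r0; rewrite /vcomp /u /velocity mxE mulrA divff// mul1r. Qed.

(** Stated at a point where [rho] is nonzero, not for positive [rho], since it is
    used to prove positivity; [m = rho u] then holds near that point. *)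
Lemma balance_mass z : A z -> rho z != 0 -> balance eps u rho z = 0.
Proof.
move=> Az r0; have := mass_equation sol Az.
have -> : divergence m z = rho z * divergence u z + advection u rho z.
  rewrite -(divergenceZ Cr Cu Az); apply: eq_bigr => i _.
  apply: near_eq_derive.
  have cr : {for z, continuous rho}.
    exact: differentiable_continuous (class_C1_diff Cr Az).
  near=> y; have r0y : rho y != 0 by near: y; exact: cvgr_neq0 cr r0.
  by rewrite (momentumE i y r0y) [RHS]mxE.
rewrite /balance; abstract_atoms; move=> *; lra.
Unshelve. all: by end_near. Qed.

Hypothesis rho_gt0 : forall z, A z -> 0 < rho z.

Let r0 z : A z -> rho z != 0. Proof. by move=> Az; rewrite gt_eqF// rho_gt0. Qed.

Let Ce : class_C 2 A e.
Proof. exact: (class_C_internal_energy (phi := id) oA r0 Cr CE Cu CB). Qed.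

Lemma total_energyE z : A z -> E z =
  rho z * (e z + 2^-1 * dot (u z) (u z)) + 2^-1 * dot (B z) (B z).
Proof.
move=> Az; rewrite /e /internal_energy -/u.
by move: (rho z) (r0 z Az) (dot _ _) (dot _ _) => r rn a b; field.
Qed.

Hypothesis thermo : entropy_pressure Ie s p.

Lemma admissible_state z : A z -> states Ie (rho z, e z).
Proof.
move=> Az; split; first exact: rho_gt0.
by apply: (energy_admissible sol); [exact: ltW|exact: rho_gt0].
Qed.

(** The smoothness of [p] is that of [s]: on admissible states the equation of
    state reads [p = - rho^2 s_rho / s_e]. *)
Lemma class_C_pressure : class_C 2 A P.
Proof.
have Cs1 : class_C 2 (states Ie) (partial1 s).
  exact: class_C_derive (entropy_smooth thermo 3).
have Cs2 : class_C 2 (states Ie) (partial2 s).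
  exact: class_C_derive (entropy_smooth thermo 3).
have C1 := class_C_comp2 oA admissible_state Cs1 Cr Ce.
have C2 := class_C_comp2 oA admissible_state Cs2 Cr Ce.
have T0 z : A z -> partial2 s (rho z, e z) != 0.
  by move=> Az; apply: lt0r_neq0; exact (temperature_gt0 thermo (admissible_state z Az)).
have CP := class_CN oA (class_CM oA (class_CM oA (class_CM oA Cr Cr) C1)
  (class_C_inv oA T0 C2)).
apply: (class_C_eq oA _ CP) => z Az.
have := equation_of_state thermo (admissible_state z Az).
have := T0 z Az; rewrite /= /P.
move: (partial1 s _) (partial2 s _) (p _) => s1 s2 pz s20 eos.
by apply: (mulIf s20); rewrite mulNr mulfVK//; lra.
Qed.

Lemma balance_momentum j z : A z ->
  balance eps u (fun y => rho y * vcomp u j y) z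
  = - dx j P z + mx_divergence (maxwell_stress B) j z.
Proof.
move=> Az; have := momentum_equation sol j Az.
rewrite -/u -/e -/(P z).
have mE y : A y -> vcomp m j y = rho y * vcomp u j y.
  by move=> Ay; exact: momentumE (r0 y Ay).
rewrite (dt_eq_on oA mE Az) (laplacian_eq_on oA mE Az).
have Cf := class_CM oA Cr (Cu j).
have CP := class_C_pressure.
have -> : mx_divergence (fun z' => outer (m z') (u z') + (P z')%:M) j z
    = rho z * vcomp u j z * divergence u z
      + advection u (fun y => rho y * vcomp u j y) z + dx j P z.
  have -> : dx j P z = \sum_i (i == j)%:R * dx i P z.
    rewrite (bigD1 j)//= eqxx mul1r big1 ?addr0// => i /negbTE ->.
    by rewrite mul0r.
  rewrite /divergence /advection mulr_sumr -!big_split/=; apply: eq_bigr => i _.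
  have dP := class_C1_diff CP Az; have df := class_C1_diff Cf Az.
  have dui := class_C1_diff (Cu i) Az.
  have E1 y : A y -> (outer (m y) (u y) + (P y)%:M) i j =
      (rho y * vcomp u j y) * vcomp u i y + (i == j)%:R * P y.
    move=> Ay; rewrite [LHS]mxE outerE [(P y)%:M i j]mxE -/(vcomp m i y).
    rewrite (momentumE i y (r0 y Ay)).
    by congr (_ + _); [exact: mulrAC|rewrite mulr_natl].
  have dc : differentiable (fun=> (i == j)%:R : R) z by exact: differentiable_cst.
  rewrite [LHS](derive_eq_on oA E1 Az).
  rewrite (deriveD_fun (differentiableM df dui) (differentiableM dc dP)).
  rewrite (deriveM_fun df dui) (deriveM_fun dc dP).
  by rewrite derive_cst mulr0 addr0.
rewrite /balance; abstract_atoms; move=> *; lra.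
Qed.

Lemma balance_magnetic j z : A z ->
  balance eps u (vcomp B j) z = advection B (vcomp u j) z.
Proof.
move=> Az; have := induction_equation sol j Az; rewrite -/u.
have -> : mx_divergence (fun z' => outer (u z') (B z') - outer (B z') (u z')) j z
    = vcomp B j z * divergence u z + advection u (vcomp B j) z
      - (vcomp u j z * divergence B z + advection B (vcomp u j) z).
  rewrite /divergence /advection !mulr_sumr -!big_split -sumrB/=; apply: eq_bigr => i _.
  have dui := class_C1_diff (Cu i) Az; have duj := class_C1_diff (Cu j) Az.
  have dBi := class_C1_diff (CB i) Az; have dBj := class_C1_diff (CB j) Az.
  have E1 y : A y -> (outer (u y) (B y) - outer (B y) (u y)) i j =
      vcomp B j y * vcomp u i y + (- vcomp u j y) * vcomp B i y.
    move=> Ay; rewrite [LHS]mxE outerE [X in _ + X]mxE outerE.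
    by rewrite mulNr [vcomp u j y * _]mulrC [vcomp B j y * _]mulrC.
  have dNuj : differentiable (fun y => - vcomp u j y) z by exact: differentiableN.
  have DN : 'D_(delta_mx 0 i, 0) (fun y => - vcomp u j y) z = - dx i (vcomp u j) z.
    by apply: deriveN; exact: diff_derivable.
  rewrite [LHS](derive_eq_on oA E1 Az).
  rewrite (deriveD_fun (differentiableM dBj dui) (differentiableM dNuj dBi)).
  rewrite (deriveM_fun dBj dui) (deriveM_fun dNuj dBi) DN.
  by rewrite /dx; abstract_atoms; ring.
rewrite (magnetic_div0 sol (ltW Az)) /balance; abstract_atoms; move=> *; lra.
Qed.

Lemma balance_energy z : A z ->
  balance eps u (fun y => rho y * (e y + 2^-1 * dot (u y) (u y))
                          + 2^-1 * dot (B y) (B y)) z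
  = - (P z * divergence u z + advection u P z)
    + divergence (fun y => u y *m maxwell_stress B y) z.
Proof.
move=> Az; have := energy_equation sol Az; rewrite -/u -/e -/(P z).
have CP := class_C_pressure.
rewrite -(balance_eq_on oA total_energyE Az).
have -> : divergence (fun z' => (E z' + P z') *: u z') z
    = (E z + P z) * divergence u z + advection u E z + advection u P z.
  by rewrite (divergenceZ (class_CD oA CE CP) Cu Az) (advectionD CE CP Az) addrA.
rewrite /balance; abstract_atoms; move=> *; lra.
Qed.

Lemma class_C_entropy : class_C 2 A (fun y => s (rho y, e y)).
Proof. exact: class_C_comp2 oA admissible_state (entropy_smooth thermo 2) Cr Ce. Qed.

Lemma entropy_transport_ge0 z : 0 <= eps -> A z ->
  0 <= transport eps rho u (fun y => s (rho y, e y)) z.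
Proof.
move=> eps0 Az; have mass := balance_mass z Az (r0 z Az).
apply: (transport_entropy_ge0 (P := P) (B := B) oA Cr Ce rho_gt0 Az mass thermo) => //.
  by move=> y Ay; exact: (admissible_state y Ay).2.
apply: (transport_internal_energy oA Cr Ce Cu CB rho_gt0 Az mass).
- by move=> j; exact: balance_momentum.
- by move=> j; exact: balance_magnetic.
- exact: balance_energy.
Qed.

End conservation_laws.

(** * Minimum principles for the density and the entropy *)

Section bounds.
Context {R : realType} {d : nat}.

Lemma continuous_bounded_above {X : topologicalType} {f : X -> R} {K : set X} :
  compact K -> continuous f -> exists M, forall x, K x -> f x <= M.
Proof.
move=> cK cf; have [K0|/nonemptyPn K0] := pselect (K !=set0); last first.
  by exists 0 => x; rewrite K0.
have [c _ cmax] := compact_EVT_max K0 cK (continuous_subspaceT cf).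
by exists (f c) => x Kx; apply: cmax; rewrite inE.
Qed.

Lemma divergence_bounded_above {a : 'rV[R]_d * R -> 'rV[R]_d} {K : set 'rV[R]_d} (T : R) :
  smooth_vfield a -> compact K ->
  exists M, forall z, K z.1 -> 0 < z.2 -> z.2 <= T -> divergence a z <= M.
Proof.
move=> sa cK; have bound i : exists M, forall z, K z.1 -> 0 < z.2 -> z.2 <= T ->
    dx i (vcomp a i) z <= M.
  have [U [F [hU CF _ dF]]] := smooth_field_extension (sa i).
  have CG : class_C 0 U (dx i F) by exact: class_C_derive (CF 1).
  have cKT : compact (K `*` `[0, T]%classic).
    by apply: compact_setX => //; exact: segment_compact.
  have [M HM] := continuous_bounded_above cKT (continuous_on_clamp_time hU CG).
  exists M => z Kz z0 zT; rewrite dF// -[in dx i F z](clamp_time_id z (ltW z0)).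
  by apply: HM; split=> //=; rewrite in_itv/= ltW.
have [M HM] := choice bound.
by exists (\sum_i M i) => z Kz z0 zT; apply: ler_sum => i _; exact: HM.
Qed.

End bounds.

Section minimum_principles.
Context {R : realType} {d : nat} {Ie : set R} {s p : R * R -> R} {eps : R}.
Context {rho E : 'rV[R]_d * R -> R} {m B : 'rV[R]_d * R -> 'rV[R]_d}.
Hypothesis sol : smooth_mhd_solution Ie p eps rho m E B.
Hypothesis eps_gt0 : 0 < eps.
Hypothesis rho0_gt0 : forall x, 0 < rho (x, 0).
Context {K : set 'rV[R]_d} (cK : compact K).

Lemma is_derive_expR_decay (c M t : R) :
  is_derive t 1 (fun s : R => c * expR (- M * s)) (- M * (c * expR (- M * t))).
Proof.
have D : is_derive t (1 : R) (fun s : R => - M * s) (- M).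
  exact: (is_derive_eq (@is_deriveZ _ _ _ id (- M) t 1 1 (is_derive_id t 1))
    (mulr1 _)).
have H := @is_deriveZ _ _ _ _ c t 1 _
  (is_derive1_comp (is_derive_expR (- M * t)) D).
by apply: (is_derive_eq H); rewrite /= [LHS]mulrA mulrC.
Qed.

(** Outside [K] the initial density has a single value, taken at some [x1] unless
    [K] is everything, so its infimum is a minimum over [K] with [x1] added. *)
Lemma initial_density_lower_bound :
  (forall x y, ~ K x -> ~ K y -> rho (x, 0) = rho (y, 0)) ->
  exists c, 0 < c /\ forall x, c < rho (x, 0).
Proof.
move=> cst; have [x1 Hx1] : exists x1, forall x, ~ K x -> rho (x, 0) = rho (x1, 0).
  have [[x1 nK]|all] := pselect (exists x1, ~ K x1).
    by exists x1 => x nKx; exact: cst.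
  by exists 0 => x nKx; case: all; exists x.
have cr : continuous (fun x : 'rV[R]_d => rho (x, 0)).
  have -> : (fun x => rho (x, 0)) = (rho \o clamp_time) \o (fun x => (x, 0)).
    by apply/funext => x /=; rewrite clamp_time_id.
  move=> x; apply: continuous_comp;
    last exact: smooth_field_continuous (density_smooth sol) _.
  have cx : {for x, continuous (fun y : 'rV[R]_d => y)} by exact: cvg_id.
  have c0 : {for x, continuous (fun=> 0 : R)} by exact: cst_continuous.
  exact: (cvg_pair cx c0).
have K'0 : (K `|` [set x1]) !=set0 by exists x1; right.
have cK' : compact (K `|` [set x1]) by apply: compactU => //; exact: compact_set1.
have [x2 _ x2min] := compact_EVT_min K'0 cK' (continuous_subspaceT cr).
exists (rho (x2, 0) / 2); split; first by rewrite divr_gt0.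
move=> x; have : rho (x2, 0) <= rho (x, 0).
  have [Kx|nKx] := pselect (K x); first by apply: x2min; rewrite inE; left.
  by rewrite (Hx1 x nKx); apply: x2min; rewrite inE; right.
have := rho0_gt0 x2; lra.
Qed.

Hypothesis rho_const : forall x t, ~ K x -> 0 <= t -> rho (x, t) = rho (x, 0).
Hypothesis rho_far : forall x y, ~ K x -> ~ K y -> rho (x, 0) = rho (y, 0).

(** The barrier is [c exp (- M t)] with [M > div u] on [K x ]0, T]].  At a contact
    the mass balance gives [dt rho >= - rho div u > - M rho], the slope of the
    barrier there. *)
Lemma density_gt0 z : 0 <= z.2 -> 0 < rho z.
Proof.
case: z => x T /= T0; have [c [c0 cmin]] := initial_density_lower_bound rho_far.
have [M0 HM0] := divergence_bounded_above T (velocity_smooth sol) cK.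
pose M := `|M0| + 1; have M_gt0 : 0 < M by rewrite ltr_wpDl.
pose b t : R := c * expR (- M * t).
have b_gt0 t : 0 < b t by rewrite mulr_gt0// expR_gt0.
have b_le t : 0 <= t -> b t <= c.
  move=> t0; rewrite /b ger_pMr// expR_le1 mulNr oppr_le0 mulr_ge0//; exact: ltW.
apply: lt_trans (b_gt0 T) _.
apply: (barrier_principle (fun t => - M * b t) K T) => //.
- exact: smooth_field_continuous (density_smooth sol).
- exact: smooth_field_class_C (density_smooth sol).
- by move=> t; exact: is_derive_expR_decay.
- by move=> y; exact: le_lt_trans (b_le 0 (lexx 0)) (cmin y).
- by move=> y t nKy t0 _; rewrite rho_const//; exact: le_lt_trans (b_le t t0) (cmin y).
move=> z Kz z0 zT zb dx0 lap0 dtb.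
have r0 : 0 < rho z by rewrite zb.
have := balance_mass sol z z0 (lt0r_neq0 r0).
rewrite /balance {1}/advection big1 ?addr0 => [mass|i _]; last by rewrite dx0 mulr0.
have elap : 0 <= eps * laplacian rho z by rewrite mulr_ge0// ltW.
have rM : rho z * divergence (velocity rho m) z <= rho z * `|M0|.
  by rewrite ler_pM2l//; exact: le_trans (HM0 z Kz z0 zT) (ler_norm _).
move: dtb; rewrite -zb /M.
by move: mass elap rM r0; abstract_atoms; move=> *; lra.
Qed.

Hypothesis thermo : entropy_pressure Ie s p.
Let e := internal_energy rho m E B.
Let S z := s (rho z, e z).

Lemma continuous_entropy : continuous (S \o clamp_time).
Proof.
have C0 f : continuous f -> class_C 0 setT f by move=> cf z _; exact: cf.
have Sf (f : 'rV[R]_d * R -> R) : smooth_field f -> class_C 0 setT (f \o clamp_time).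
  by move=> sf z _; exact: smooth_field_continuous sf z.
have Cr := Sf _ (density_smooth sol).
have r_gt0 z : 0 < rho (clamp_time z) by apply: density_gt0; exact: clamp_time_ge0.
have Ce : class_C 0 setT (e \o clamp_time).
  apply: class_C_internal_energy Cr _ _ _.
  - exact: openT.
  - by move=> z _; rewrite gt_eqF.
  - exact: Sf (energy_smooth sol).
  - by move=> j; exact: Sf (velocity_smooth sol j).
  - by move=> j; exact: Sf (magnetic_smooth sol j).
have St z : [set: _] z -> states Ie (rho (clamp_time z), e (clamp_time z)).
  move=> _; split; first exact: r_gt0.
  by apply: (energy_admissible sol); [exact: clamp_time_ge0|exact: r_gt0].
move=> z; exact: (class_C_comp2 openT St (entropy_smooth thermo 0) Cr Ce).
Qed.

Hypothesis e_const : forall x t, ~ K x -> 0 <= t -> e (x, t) = e (x, 0).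

(** The barrier [c - delta (1 + t)] stays below [c] and falls at rate [delta],
    while [dt S >= 0] at a contact.  If [S] were less than [c] at [(x, T)], then
    [delta] can be chosen to make the barrier reach that value at time [T]. *)
Lemma entropy_minimum_principle c : (forall x, c <= S (x, 0)) ->
  forall x t, 0 <= t -> c <= S (x, t).
Proof.
move=> S0 x T T0; rewrite leNgt; apply/negP => Slt.
pose delta := (c - S (x, T)) / (1 + T).
have T1 : 0 < 1 + T by rewrite ltr_pwDl.
have delta0 : 0 < delta by rewrite divr_gt0// subr_gt0.
pose b t : R := c - delta * (1 + t).
have b_lt t : 0 <= t -> b t < c.
  by move=> t0; rewrite /b gtrBl mulr_gt0// ltr_pwDl.
have rho_gt0 z : open_spacetime z -> 0 < rho z.
  by move=> z0; apply: density_gt0; exact: ltW.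
suff : b T < S (x, T) by rewrite /b /delta divfK ?gt_eqF// subKr ltxx.
apply: (barrier_principle (fun=> - delta) K T) => //.
- exact: continuous_entropy.
- exact: class_C_entropy sol rho_gt0 thermo.
- move=> t.
  have D := is_deriveB (is_derive_cst (c - delta) t 1)
    (@is_deriveZ _ _ _ id delta t 1 1 (is_derive_id t 1)).
  rewrite (_ : b = cst (c - delta) - delta \*: id).
    by apply: (is_derive_eq D); rewrite sub0r [_ *: _]mulr1.
  by apply/funext => r; rewrite !fctE /b mulrDr mulr1 opprD addrA.
- by move=> y; exact: lt_le_trans (b_lt 0 (lexx 0)) (S0 y).
- move=> y t nKy t0 _; rewrite /S rho_const// e_const//.
  exact: lt_le_trans (b_lt t t0) (S0 y).
move=> z Kz z0 zT zb dx0 lap0 dtb.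
have := entropy_transport_ge0 sol rho_gt0 thermo z (ltW eps_gt0) z0.
rewrite /transport {1}/advection big1 => [|i _];
  last by rewrite [dx i _ _]dx0 mulr0.
rewrite {1}/grad_dot big1 => [|i _]; last by rewrite [X in _ * X]dx0 mulr0.
rewrite mulr0 !addr0 subr_ge0 => elap.
have : 0 <= dt S z by apply: le_trans elap; rewrite mulr_ge0// ltW.
move: dtb; move: (dt S z) => ds h1 h2; have := le_trans h2 h1.
by rewrite oppr_ge0 leNgt delta0.
Qed.

End minimum_principles.

Theorem theorem2 (R : realType) (d : nat) (d_ge1 : (1 <= d)%N)
    (Ie : set R) (s p : R * R -> R) (thermo : entropy_pressure Ie s p)
    (eps : R) (eps_gt0 : 0 < eps)
    (rho E : 'rV[R]_d * R -> R) (m B : 'rV[R]_d * R -> 'rV[R]_d)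
    (sol : smooth_mhd_solution Ie p eps rho m E B)
    (rho0_gt0 : forall x : 'rV[R]_d, 0 < rho (x, 0))
    (hyp_i_u : forall j : 'I_d, L1_spacetime (vcomp (velocity rho m) j))
    (hyp_i_div : L1_spacetime (divergence (velocity rho m)))
    (hyp_ii_mass : L1_space (time_integral `[0, +oo[
       (fun z => dt rho z + divergence m z)))
    (hyp_ii_grad : forall i : 'I_d, L1_space (time_integral `[0, +oo[
       (fun z => eps * dx i rho z)))
    (hyp_iii_lower : exists rho_min : R, 0 < rho_min /\
       forall T : R, 0 < T -> exists r : R,
       forall (x : 'rV[R]_d) (t : R),
         r < enorm x -> 0 < t -> t < T -> rho_min <= rho (x, t))
    (hyp_iii_div : forall T : R, 0 < T ->
       Linfty_space (time_integral `[0, T]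
         (fun z => Num.max (divergence (velocity rho m) z) 0)))
    (hyp_iv : forall j : 'I_d, L1_spacetime (vcomp B j))
    (rho_star e_star : R)
    (hyp_v_unif : forall eta : R, 0 < eta -> exists r : R,
       forall (x : 'rV[R]_d) (t : R), r < enorm x -> 0 <= t ->
         `|rho (x, t) - rho_star| < eta /\
         `|internal_energy rho m E B (x, t) - e_star| < eta)
    (hyp_v_const : exists K : set 'rV[R]_d, compact K /\
       forall (x : 'rV[R]_d) (t : R), ~ K x -> 0 <= t ->
         rho (x, t) = rho_star /\ internal_energy rho m E B (x, t) = e_star) :
  let S (t : R) (x : 'rV[R]_d) : \bar R :=
    (s (rho (x, t), internal_energy rho m E B (x, t)))%:E in
  forall t : R, 0 < t ->
    (ereal_inf (range (S t)) >= ereal_inf (range (S 0%R)))%E.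
Proof.
move=> S t t0; have [K [cK far]] := hyp_v_const.
apply: le_ereal_inf_tmp => _ [x _ <-].
case E0 : (ereal_inf (range (S 0%R))) => [c| |]; last exact: leNye.
- rewrite lee_fin.
  apply: (@entropy_minimum_principle R d Ie s p eps rho E m B sol eps_gt0
    rho0_gt0 K cK) => //.
  + by move=> y r nK r0; rewrite (far y r nK r0).1 (far y 0 nK (lexx 0)).1.
  + by move=> y1 y2 n1 n2; rewrite (far y1 0 n1 (lexx 0)).1 (far y2 0 n2 (lexx 0)).1.
  + by move=> y r nK r0; rewrite (far y r nK r0).2 (far y 0 nK (lexx 0)).2.
  + by move=> y; rewrite -lee_fin -E0; apply: ereal_inf_lbound; exists y.
  + exact: ltW.
- have : (ereal_inf (range (S 0%R)) <= S 0%R x)%E by apply: ereal_inf_lbound; exists x.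
  by rewrite E0.
Qed.
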